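(* Let $T$ be a complete theory expanding the theory of integral domains, with an existential matroid $\mathrm{cl}$ on its monster model, and let $\mathbb M^*=\langle\mathbb B^*,\mathbb A^*\rangle$ be a $\kappa$-saturated and strongly $\kappa$-homogeneous monster model of $T^d$. Then the small closure $\mathrm{Scl}$, defined by $\mathrm{Scl}(X):=\mathrm{cl}(X\cup\mathbb A^* )$ for $X\subseteq\mathbb B^*$, is an existential matroid on $\mathbb M^*$ (with respect to the theory $T^d$).
   Context: Conventions: a monster model of a complete theory $T$ (in a language $\mathcal L$, with only infinite models) is a $\kappa$-saturated, strongly $\kappa$-homogeneous model $\mathbb M$, for a large cardinal $\kappa>|T|$. ''Small'' means of cardinality $<\kappa$; ''definable'' means definable with parameters. A (finitary) matroid on $\mathbb M$ is an operator $\mathrm{cl}:\mathcal P(\mathbb M)\to\mathcal P(\mathbb M)$ with: $X\subseteq \mathrm{cl}(X)$; $X\subseteq Y\Rightarrow \mathrm{cl}(X)\subseteq \mathrm{cl}(Y)$; $\mathrm{cl}(\mathrm{cl}(X))=\mathrm{cl}(X)$; $\mathrm{cl}(X)=\bigcup\{\mathrm{cl}(A): A\subseteq X \text{ finite}\}$; and exchange: $a\in \mathrm{cl}(X\cup\{c\})\setminus \mathrm{cl}(X)$ implies $c\in\mathrm{cl}(X\cup\{a\})$. A formula $\phi(x,\bar y)$ without parameters (in the language of the theory considered), $x$ a single variable, is $x$-narrow if for all $a,\bar b$, $\mathbb M\models\phi(a,\bar b)$ implies $a\in\mathrm{cl}(\bar b)$. The matroid is definable if for every $A$, $\mathrm{cl}(A)$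 is the union of the sets $\phi(\mathbb M,\bar a)$ with $\phi$ $x$-narrow and $\bar a$ a finite tuple from $A$. It satisfies Existence if for every element $a$ and all small $B,C$ with $a\notin\mathrm{cl}(B)$ there is $a'$ with the same type as $a$ over $B$ and $a'\notin\mathrm{cl}(B\cup C)$. The trivial matroid is $\mathrm{cl}^0(X)=\mathbb M$ for all $X$. An existential matroid is a definable matroid that satisfies Existence and is not trivial. Via the $x$-narrow formulas, $\mathrm{cl}$ transfers to any other monster model of $T$, in particular to $\mathbb B^*$. $\mathrm{rk}(\bar b/A)$ is the cardinality of a maximal subtuple of $\bar b$ that is $\mathrm{cl}$-independent over $A$. For $V\subseteq\mathbb M^n$ definable over a small $A$, $\dim(V)=\max\{\mathrm{rk}(\bar b/A):\bar b\in V\}$, $\dim(\emptyset)=-\infty$. Since $T$ expands the theory of integral domains, this dimension is definable in families. Let $\mathbb K\models T$, viewed as an elementary substructure of a monster model; the dimension of a $\mathbb K$-definable set is that of its interpretation in the monster model. $X\subseteq\mathbb K$ is dense in $\mathbb K$ if $U\cap X\neq\emptyset$ for every $\mathbb K$-definable $U\subseteq\mathbb K$ with $\dim(U)=1$; $X$ is $\mathrm{cl}$-closed in $\mathbb K$ if $\mathrm{cl}(X)\cap\mathbb K=X$. $\mathcal L^2$ is $\mathcal L$ with a new unary predicate $P$. $T^d$ is the (complete) $\mathcal L^2$-theory whose models are the pairs $\langle\mathbb K,\mathbb F\rangle$ with $\mathbb K\models T$ and $\mathbb F=P(\mathbb K)$ a proper subset of $\mathbb K$ that is $\mathrm{cl}$-closed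 and dense in $\mathbb K$ (it then follows that $\mathbb F\prec\mathbb K$). *)

(* Defs.v *)
From Stdlib Require List.
From mathcomp Require Import all_boot.
From mathcomp Require Import boolp classical_sets functions cardinality.

Set Implicit Arguments.
Unset Strict Implicit.
Unset Printing Implicit Defensive.

Local Open Scope classical_set_scope.
Local Open Scope card_scope.

Record language := Language {
  fsym : nat -> Type;
  rsym : nat -> Type }.

(* Formulas are well scoped, with de Bruijn variables: the free variables of
   [phi : formula L n] are among 0, ..., n - 1, and a quantifier binds
   variable 0 of its body and shifts the other ones. *)
Inductive term (L : language) (n : nat) : Type :=
  | TVar of 'I_n
  | TFun k (f : fsym L k) (ts : 'I_k -> term L n).
Arguments TVar {L n}.
Arguments TFun {L n k}.

Inductive formula (L : language) : nat -> Type :=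
  | FBot n : formula L n
  | FEq n (s t : term L n) : formula L n
  | FRel n k (r : rsym L k) (ts : 'I_k -> term L n) : formula L n
  | FImp n (phi psi : formula L n) : formula L n
  | FAll n (phi : formula L n.+1) : formula L n.
Arguments FBot {L n}.
Arguments FEq {L n}.
Arguments FRel {L n k}.
Arguments FImp {L n}.
Arguments FAll {L n}.

Definition FNot L n (phi : formula L n) : formula L n := FImp phi FBot.

(* Empty carriers are not excluded; they do not occur for the languages of
   rings used below, which have constants. *)
Record structure (L : language) := Structure {
  carrier :> Type;
  ifun : forall k, fsym L k -> k.-tuple carrier -> carrier;
  irel : forall k, rsym L k -> k.-tuple carrier -> Prop }.

Fixpoint teval L (M : structure L) n (v : n.-tuple M) (t : term L n) : M :=
  match t with
  | TVar i => tnth v i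
  | TFun _ f ts => ifun f [tuple teval v (ts i) | i < _]
  end.

Fixpoint holds L (M : structure L) n (phi : formula L n) : n.-tuple M -> Prop :=
  match phi in formula _ m return m.-tuple M -> Prop with
  | FBot _ => fun=> False
  | FEq _ s t => fun v => teval v s = teval v t
  | FRel _ _ r ts => fun v => irel r [tuple teval v (ts i) | i < _]
  | FImp _ phi psi => fun v => holds phi v -> holds psi v
  | FAll _ phi => fun v => forall x : M, holds phi [tuple of x :: v]
  end.

Definition sentence L := formula L 0.
Definition theory L := set (sentence L).

Definition models L (M : structure L) (T : theory L) : Prop :=
  forall s, T s -> holds s ([tuple] : 0.-tuple M).

Definition entails L (T : theory L) (s : sentence L) : Prop :=
  forall M : structure L, models M T -> holds s ([tuple] : 0.-tuple M).

Definition complete L (T : theory L) : Prop :=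
  (exists M : structure L, models M T) /\
  forall s, entails T s \/ entails T (FNot s).

Definition only_infinite_models L (T : theory L) : Prop :=
  forall M : structure L, models M T -> infinite_set [set: M].

Definition elementary_embedding L (M N : structure L) (e : M -> N) : Prop :=
  forall n (phi : formula L n) (v : n.-tuple M),
    holds phi v <-> holds phi [tuple of map e v].

Definition automorphism L (M : structure L) (s : M -> M) : Prop :=
  [/\ bijective s,
      forall k (f : fsym L k) v, s (ifun f v) = ifun f [tuple of map s v] &
      forall k (r : rsym L k) (v : k.-tuple M),
        irel r v <-> irel r [tuple of map s v]].

Definition tuple_in (M : Type) (A : set M) n (v : n.-tuple M) : Prop :=
  forall i, A (tnth v i).

(* A formula phi(x, c) in the single variable x = variable 0, with
   parameters c from M. *)
Record pformula L (M : structure L) := PFormula {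
  parity : nat;
  pform : formula L parity.+1;
  pparams : parity.-tuple M }.

Definition pholds L (M : structure L) (p : pformula M) (x : M) : Prop :=
  holds (pform p) [tuple of x :: pparams p].

Definition pover L (M : structure L) (A : set M) (p : pformula M) : Prop :=
  tuple_in A (pparams p).

Definition same_type L (M : structure L) (A : set M) (a b : M) : Prop :=
  forall p : pformula M, pover A p -> (pholds p a <-> pholds p b).

Definition card_lt T U (A : set T) (B : set U) : Prop :=
  A #<= B /\ ~ (B #<= A).

(* The cardinal kappa is represented by a type of that cardinality. *)
Definition small (kappa : Type) M (A : set M) : Prop :=
  card_lt A [set: kappa].

(* |T| is the number of formulas of its language, that is |L| + aleph_0. *)
Definition theory_card_lt (L : language) (kappa : Type) : Prop :=
  card_lt [set: {n : nat & formula L n}] [set: kappa].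

Definition finitely_satisfiable L (M : structure L) (p : set (pformula M)) :=
  forall s : seq (pformula M), (forall f, List.In f s -> p f) ->
    exists x : M, forall f, List.In f s -> pholds f x.

Definition saturated (kappa : Type) L (M : structure L) : Prop :=
  forall (A : set M) (p : set (pformula M)),
    small kappa A -> p `<=` pover A -> finitely_satisfiable p ->
    exists x : M, forall f, p f -> pholds f x.

(* A partial elementary map is represented by a total function of which only
   the values on the domain [A] matter. *)
Definition partial_elementary L (M : structure L) (A : set M) (f : M -> M) :=
  forall n (phi : formula L n) (v : n.-tuple M), tuple_in A v ->
    (holds phi v <-> holds phi [tuple of map f v]).

Definition strongly_homogeneous (kappa : Type) L (M : structure L) : Prop :=
  forall (A : set M) (f : M -> M), small kappa A -> partial_elementary A f ->
    exists2 s, automorphism s & forall x, A x -> s x = f x.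

Definition monster (kappa : Type) L (T : theory L) (M : structure L) : Prop :=
  [/\ models M T, saturated kappa M & strongly_homogeneous kappa M].

Definition exchange M (cl : set M -> set M) : Prop :=
  forall X a c, (cl (X `|` [set c]) `\` cl X) a -> cl (X `|` [set a]) c.

Definition matroid M (cl : set M -> set M) : Prop :=
  [/\ forall X, X `<=` cl X,
      forall X Y, X `<=` Y -> cl X `<=` cl Y,
      forall X, cl (cl X) = cl X,
      forall X, cl X = \bigcup_(A in [set A | A `<=` X /\ finite_set A]) cl A &
      exchange cl].

(* Variable 0 is x, the remaining ones are the tuple y. *)
Definition narrow L (M : structure L) (cl : set M -> set M)
    n (phi : formula L n.+1) : Prop :=
  forall (a : M) (b : n.-tuple M),
    holds phi [tuple of a :: b] -> cl (range (tnth b)) a.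

(* The union, inside N, of the sets phi(N, c) with phi in the class [Phi] of
   formulas and c a finite tuple from A. For Phi the class of the narrow
   formulas of a definable matroid on one model of T, this is its transfer
   to the model N of T. *)
Definition formula_closure L (Phi : forall n, formula L n.+1 -> Prop)
    (N : structure L) (A : set N) : set N :=
  [set a | exists n (phi : formula L n.+1) (c : n.-tuple N),
     [/\ Phi n phi, tuple_in A c & holds phi [tuple of a :: c]]].

Definition transfer L (M : structure L) (cl : set M -> set M)
    (N : structure L) : set N -> set N :=
  @formula_closure L (@narrow L M cl) N.

Definition definable_matroid L (M : structure L) (cl : set M -> set M) : Prop :=
  matroid cl /\ forall A, cl A = @formula_closure L (@narrow L M cl) M A.

Definition existence (kappa : Type) L (M : structure L)
    (cl : set M -> set M) : Prop :=
  forall (a : M) (B C : set M), small kappa B -> small kappa C -> ~ cl B a ->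
    exists a', same_type B a a' /\ ~ cl (B `|` C) a'.

Definition trivial_matroid M : set M -> set M := fun=> setT.

Definition existential_matroid (kappa : Type) L (M : structure L)
    (cl : set M -> set M) : Prop :=
  [/\ definable_matroid cl, existence kappa cl & cl <> @trivial_matroid M].

Definition independent M (cl : set M -> set M) (A : set M)
    n (b : n.-tuple M) (J : {set 'I_n}) : Prop :=
  forall j, j \in J ->
    ~ cl (A `|` [set tnth b i | i in [set i | i \in J /\ i != j]]) (tnth b j).

Definition has_rank M (cl : set M -> set M) (A : set M)
    n (b : n.-tuple M) (r : nat) : Prop :=
  exists2 J : {set 'I_n},
    maxset (fun J' : {set 'I_n} => `[< independent cl A b J' >]) J & #|J| = r.

(* [has_dim cl A V d] reads dim(V) = d, for d in nat and V definable over A;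
   the empty set, whose dimension is -oo, satisfies it for no d. *)
Definition has_dim M (cl : set M -> set M) (A : set M)
    n (V : set (n.-tuple M)) (d : nat) : Prop :=
  (exists2 b, V b & has_rank cl A b d) /\
  forall b r, V b -> has_rank cl A b r -> r <= d.

Definition solutions L (M : structure L) m k (phi : formula L (m + k))
    (c : k.-tuple M) : set (m.-tuple M) :=
  [set v : m.-tuple M | holds phi [tuple of v ++ c]].

Section DensePairs.
Variables (kappa : Type) (L : language) (T : theory L).
Variables (M : structure L) (cl : set M -> set M).

(* In the next two definitions K is an elementary substructure of N, by
   means of e : K -> N. *)
Definition cl_closed (K N : structure L) (e : K -> N) (X : set K) : Prop :=
  transfer cl (e @` X) `&` range e = e @` X.

Definition dense (K N : structure L) (e : K -> N) (X : set K) : Prop :=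
  forall k (phi : formula L (1 + k)) (c : k.-tuple K),
    has_dim (@transfer L M cl N) (range (tnth [tuple of map e c]))
      (@solutions L N 1 k phi [tuple of map e c]) 1 ->
    exists2 x, X x & @solutions L K 1 k phi c [tuple x].

Definition dense_pair (K : structure L) (F : set K) : Prop :=
  models K T /\
  exists (N : structure L) (e : K -> N),
    [/\ monster kappa T N, elementary_embedding e,
        F `<` setT, cl_closed e F & dense e F].

End DensePairs.

Inductive pair_rsym (L : language) : nat -> Type :=
  | OldRel k (r : rsym L k) : pair_rsym L k
  | PredP : pair_rsym L 1.
Arguments OldRel {L k}.
Arguments PredP {L}.

Definition pair_language (L : language) : language :=
  Language (fsym L) (pair_rsym L).

Definition reduct L (N : structure (pair_language L)) : structure L :=
  @Structure L (carrier N) (fun k f => @ifun (pair_language L) N k f)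
    (fun k r => @irel (pair_language L) N k (OldRel r)).

Definition predP L (N : structure (pair_language L)) : set (reduct N) :=
  [set x | @irel (pair_language L) N 1 PredP [tuple x]].
Arguments predP {L} N.

(* [Td] axiomatizes the class of dense pairs of models of [T], hence is T^d
   up to logical equivalence. *)
Definition dense_pair_theory (kappa : Type) L (T : theory L)
    (M : structure L) (cl : set M -> set M)
    (Td : theory (pair_language L)) : Prop :=
  forall N : structure (pair_language L),
    models N Td <-> dense_pair kappa T cl (predP N).

(* Given cl on the monster model M of T, transferred to the reduct of N. *)
Definition Scl L (M : structure L) (cl : set M -> set M)
    (N : structure (pair_language L)) (X : set N) : set N :=
  @transfer L M cl (reduct N) (X `|` predP N).

Record ring_symbols (L : language) := RingSymbols {
  sym0 : fsym L 0;
  sym1 : fsym L 0;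
  symN : fsym L 1;
  symD : fsym L 2;
  symM : fsym L 2 }.

Definition integral_domain R (zero one : R) (opp : R -> R)
    (add mul : R -> R -> R) : Prop :=
  [/\ associative add, commutative add, left_id zero add &
      left_inverse zero opp add] /\
  [/\ associative mul, commutative mul, left_id one mul &
      left_distributive mul add] /\
  one <> zero /\
  forall x y, mul x y = zero -> x = zero \/ y = zero.

Definition expands_integral_domains L (T : theory L) (S : ring_symbols L) :=
  forall K : structure L, models K T ->
    integral_domain (ifun (sym0 S) ([tuple] : 0.-tuple K))
      (ifun (sym1 S) ([tuple] : 0.-tuple K))
      (fun x : K => ifun (symN S) [tuple x])
      (fun x y : K => ifun (symD S) [tuple x; y])
      (fun x y : K => ifun (symM S) [tuple x; y]).

(* Main.v *)
(* Let K be the L-reduct of M^* = <K, F>. Types of finite tuples can be moved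
   between the saturated models K and M of T, so the transfer of cl to K is a
   matroid with Existence, and Scl is its localization at F ; its definability
   comes from quantifying the parameters in F existentially.

   Existence for Scl rests on two facts. (1) An L-formula over a finite w with a
   solution outside cl(w) has solutions outside cl(w F). Otherwise, for some m,
   each solution lies in cl(z w) with z in F of length m. Take b not in F,
   polynomials p of degree m with independent coefficients in F such that p(b)
   is a solution (density provides the constant term), and m + 1 independent
   conjugates of a basis of (b, w) over F : the values of p at the conjugates
   of b determine its coefficients, which therefore all lie in the closure of m
   elements z of F and of finitely many elements used at the start, contrary to
   exchange. (2) The finite L-elementary maps which preserve F, and whose domain
   and range are independent from F over their part in F, form a back-and-forth
   system, hence are elementary in the language of pairs. *)
From HB Require Import structures.
Require Import Defs.
From mathcomp Require Import all_boot ssralg poly.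
From mathcomp Require Import boolp classical_sets functions cardinality.

Set Implicit Arguments.
Unset Strict Implicit.
Unset Printing Implicit Defensive.

Local Open Scope classical_set_scope.
Local Open Scope card_scope.

(** * Smallness *)

(* The relation need not be functional, which spares a default value in [B]. *)
Lemma card_le_relP T U (A : set T) (B : set U) :
  A #<= B <-> exists R : T -> U -> Prop,
    (forall x, A x -> exists2 y, B y & R x y) /\
    (forall x x' y, R x y -> R x' y -> x = x').
Proof.
split=> [/card_leP[f]|[R [Rtot Rinj]]].
  exists (fun x y => exists2 a : A, set_val a = x & set_val (f a) = y).
  split=> [x Ax|x x' _ [a <- <-] [a' <-] /val_inj faa']; last first.
    by congr set_val; apply/esym; apply: inj faa'; exact: mem_set.
  have xA := mem_set Ax; exists (set_val (f (SigSub xA))); last by exists (SigSub xA).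
  exact: set_valP.
have /choice[f fP] (a : A) : exists b : B, R (set_val a) (set_val b).
  by have [y By Ry] := Rtot _ (set_valP a); exists (SigSub (mem_set By)).
apply/card_leP; apply: (proj2 injfunPex).
apply: (ex_intro2 _ _ f) => [//|a a' _ _ faa'].
apply: val_inj; apply: Rinj (fP a) _; rewrite faa'.
exact: fP.
Qed.

Lemma total_on_sup2 T (F : set (set T)) (p q : T) :
  total_on F subset -> (\bigcup_(X in F) X) p -> (\bigcup_(X in F) X) q ->
  exists2 X, F X & X p /\ X q.
Proof.
move=> Ftot [X FX Xp] [Y FY Yq].
by have [XY|YX] := Ftot _ _ FX FY; [exists Y|exists X] => //; split=> //;
  [exact: XY|exact: YX].
Qed.

(** By Zorn: a maximal injective matching of part of [A] with part of [B] covers one of the two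
    sets, since otherwise a missed point of each could be paired. *)
Lemma card_le_total T U (A : set T) (B : set U) : A #<= B \/ B #<= A.
Proof.
pose P (G : set (T * U)) := forall p q, G p -> G q ->
  [/\ A p.1, B p.2 & p.1 = q.1 <-> p.2 = q.2].
have [F FP Ftot|G [PG Gmax]] := @Zorn_bigcup _ P.
  move=> p q Fp Fq; have [X FX [Xp Xq]] := total_on_sup2 Ftot Fp Fq.
  exact: FP FX _ _ Xp Xq.
have [GA|/existsNP[a /not_implyP[Aa Ga]]] :=
    pselect (forall a, A a -> exists y, G (a, y)).
  left; apply/card_le_relP; exists (fun x y => G (x, y)); split=> [x Ax|x x' y Gx Gx'].
    by have [y Gy] := GA _ Ax; exists y => //; case: (PG _ _ Gy Gy).
  by case: (PG _ _ Gx Gx') => _ _ /= [_]; apply.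
have [GB|/existsNP[b /not_implyP[Bb Gb]]] :=
    pselect (forall b, B b -> exists x, G (x, b)).
  right; apply/card_le_relP; exists (fun y x => G (x, y)); split=> [y By|y y' x Gx Gx'].
    by have [x Gx] := GB _ By; exists x => //; case: (PG _ _ Gx Gx).
  by case: (PG _ _ Gx Gx') => _ _ /= [+ _]; apply.
exfalso; apply: (Gmax (G `|` [set (a, b)])).
  split; first by move=> p Gp; left.
  by move=> /(_ (a, b) (or_intror erefl)) Gab; apply: Ga; exists b.
move=> [p1 p2] [q1 q2] [Gp|[-> ->]] [Gq|[-> ->]] //=; first exact: PG Gp Gq.
  have [Ap Bp _] := PG _ _ Gp Gp; split=> //; split=> E; subst.
    by case: Ga; exists p2.
  by case: Gb; exists p1.
split=> //; split=> E; subst.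
  by case: Ga; exists q2.
by case: Gb; exists q1.
Qed.

(* A maximal disjoint family of sequences in [C] misses only finitely many
   points, which are absorbed by one of the sequences. *)
Lemma infinite_card_split T (C : set T) : infinite_set C ->
  exists E : set (nat -> T), (forall f n, E f -> C (f n)) /\
  (forall f g n m, E f -> E g -> f n = g m -> f = g /\ n = m) /\
  exists R : T -> (nat -> T) * nat -> Prop,
    (forall x, C x -> exists2 p, E p.1 & R x p) /\
    (forall x x' p, R x p -> R x' p -> x = x').
Proof.
move=> Cinf.
pose P (E : set (nat -> T)) := forall f g, E f -> E g -> forall n m,
  C (f n) /\ (f n = g m -> f = g /\ n = m).
have [F FP Ftot|E [PE Emax]] := @Zorn_bigcup _ P.
  move=> f g Ff Fg; have [X FX [Xf Xg]] := total_on_sup2 Ftot Ff Fg.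
  exact: FP FX _ _ Xf Xg.
pose D := [set x | exists2 f, E f & exists n, f n = x].
have Rfin : finite_set (C `\` D).
  apply: contrapT => /infiniteP/card_le_relP[r [rtot rinj]].
  have /choice[h hP] n : exists y, (C `\` D) y /\ r n y.
    by have [//|y ? ?] := rtot n _; exists y.
  apply: (Emax (E `|` [set h])).
    split; first by move=> f Ef; left.
    move=> /(_ h (or_intror erefl)) Eh; have [[_ nD] _] := hP 0%N.
    by apply: nD; exists h => //; exists 0%N.
  have hD f n m : E f -> f n <> h m.
    by move=> Ef fn; have [[_ nD] _] := hP m; apply: nD; exists f => //; exists n.
  move=> f g [Ef|->] [Eg|->] n m.
  - exact: PE.
  - split; first by have [] := PE _ _ Ef Ef n n.
    by move=> /hD; case.
  - by split; [have [[]]:= hP n|move=> /esym/hD; case].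
  - split; first by have [[]]:= hP n.
    move=> hnm; split=> //; have [_ rn] := hP n; have [_ rm] := hP m.
    by apply: rinj rn _; rewrite hnm.
have [f0 Ef0] : exists f0, E f0.
  apply: contrapT => nE; apply: Cinf; rewrite (_ : C = C `\` D) //.
  by rewrite setDidl// -subset0 => x [_ [f Ef _]]; apply: nE; exists f.
have /card_le_relP[r [rtot rinj]] : C `\` D #<= [set: nat].
  exact: finite_set_countable.
exists E; split; first by move=> f n Ef; have [] := PE _ _ Ef Ef n n.
split; first by move=> f g n m Ef Eg; have [] := PE _ _ Ef Eg n m.
(* Points of the sequences take the even indices; the odd indices of [f0] absorb the finitely many
   points left over. *)
exists (fun x p => (exists2 n, p.1 n = x & p.2 = n.*2) \/
                   (p.1 = f0 /\ exists2 n, r x n & p.2 = n.*2.+1)).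
split=> [x Cx|x x' [f k] /=].
  have [[f Ef [n fn]]|nDx] := pselect (D x).
    by exists (f, n.*2) => //; left; exists n.
  by have [//|n _ rn] := rtot x _; exists (f0, n.*2.+1) => //; right; split=> //; exists n.
move=> [[n <- ->]|[-> [n rn ->]]] [[m <- nm]|[_ [m rm nm]]].
- by rewrite (double_inj nm).
- by move: (congr1 odd nm); rewrite /= !odd_double.
- by move: (congr1 odd nm); rewrite /= !odd_double.
- by apply: rinj rn _; case: nm => /double_inj ->.
Qed.

(** With [C] coded by places in disjoint sequences of elements of [C], doubling the indices sends
    [C] to even places and frees the odd ones for [B], coded through its injection into [C]. *)
Lemma infinite_card_setU T (B C : set T) :
  infinite_set C -> B #<= C -> B `|` C #<= C.
Proof.
move=> /infinite_card_split[E [EC [Einj [R [Rtot Rinj]]]]].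
move=> /card_le_relP[r [rtot rinj]]; apply/card_le_relP.
exists (fun x y => exists p, R x p /\ E p.1 /\ y = p.1 p.2.*2 \/
   exists2 c, r x c & R c p /\ E p.1 /\ y = p.1 p.2.*2.+1).
split=> [x BCx|x x' y].
  have [Cx|nCx] := pselect (C x).
    have [p Ep Rp] := Rtot _ Cx; exists (p.1 p.2.*2); first exact: EC.
    by exists p; left.
  have [c Cc rc] : exists2 c, C c & r x c by case: BCx => // /rtot.
  have [p Ep Rp] := Rtot _ Cc; exists (p.1 p.2.*2.+1); first exact: EC.
  by exists p; right; exists c.
move=> [[f k]] /= H [[f' k']] /= H'.
case: H H' => [[Rp [Ep ->]]|[c rc [Rp [Ep ->]]]];
  case=> [[Rp' [Ep' fk]]|[c' rc' [Rp' [Ep' fk]]]];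
  have [E1 E2] := Einj _ _ _ _ Ep Ep' fk; subst f'.
- by apply: Rinj Rp _; rewrite (double_inj E2).
- by move: (congr1 odd E2); rewrite /= !odd_double.
- by move: (congr1 odd E2); rewrite /= !odd_double.
- case: E2 => /double_inj kk'; subst k'.
  by apply: rinj rc _; rewrite (Rinj _ _ _ Rp Rp').
Qed.

Lemma small_finite kappa T (A : set T) :
  [set: nat] #<= [set: kappa] -> finite_set A -> small kappa A.
Proof.
move=> kinf Afin; split.
  by apply: card_le_trans kinf; exact: finite_set_countable.
move=> kA; have : finite_set [set: nat].
  by apply: card_le_finite Afin; exact: card_le_trans kA.
exact/infiniteP.
Qed.

(** The larger of the two sets absorbs the other if it is infinite; otherwise the union is
    finite. *)
Lemma small_setU kappa T (A B : set T) : [set: nat] #<= [set: kappa] ->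
  small kappa A -> small kappa B -> small kappa (A `|` B).
Proof.
move=> kinf.
wlog AB : A B / A #<= B.
  move=> H sA sB; have [/H|/H] := card_le_total A B; first exact.
  by rewrite setUC; exact.
move=> sA sB; have [Bfin|Binf] := pselect (finite_set B).
  apply: small_finite => //; rewrite finite_setU; split=> //.
  exact: card_le_finite Bfin.
have [Bk kB] := sB; have ABB := infinite_card_setU Binf AB.
split; first exact: card_le_trans Bk.
by move=> kAB; apply: kB; exact: card_le_trans ABB.
Qed.

(** * Finite partial elementary relations *)

Definition elems X (s : seq X) : set X := [set x | List.In x s].

Lemma elems_cat X (s t : seq X) : elems (s ++ t) = elems s `|` elems t.
Proof. by apply/seteqP; split=> x; rewrite /elems /= List.in_app_iff. Qed.

Lemma elems_cons X x (s : seq X) : elems (x :: s) = [set x] `|` elems s.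
Proof. by apply/seteqP; split=> y [] H; [left|right|left|right]. Qed.

Lemma elems_map X Y (f : X -> Y) s : elems (map f s) = f @` elems s.
Proof.
apply/seteqP; split=> [y /List.in_map_iff[x [<- xs]]|_ [x xs <-]].
  by exists x.
by apply/List.in_map_iff; exists x.
Qed.

Lemma elems_tnth X n (v : n.-tuple X) : elems v = range (tnth v).
Proof.
have E (t : seq X) x : List.In x t <-> exists2 i, (i < size t)%N & nth x t i = x.
  elim: t => [|y t IH] /=; first by split=> // -[].
  rewrite IH; split=> [[->|[i it <-]]|[[|i] /= it <-]].
  - by exists 0%N.
  - exists i.+1 => //=; exact: set_nth_default.
  - by left.
  - by right; exists i => //; exact: set_nth_default.
apply/seteqP; split=> [x /E[i]|x [i _ <-]].
  by rewrite size_tuple => iv <-; exists (Ordinal iv) => //; rewrite (tnth_nth x).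
apply/E; exists i; first by rewrite size_tuple.
by rewrite -tnth_nth.
Qed.

Lemma tuple_inP X (A : set X) n (v : n.-tuple X) : tuple_in A v <-> elems v `<=` A.
Proof.
rewrite elems_tnth; split=> [Av _ [i _ <-] //|Av i]; exact/Av/imageP.
Qed.

Lemma finite_elems X (s : seq X) : finite_set (elems s).
Proof.
rewrite (elems_tnth (in_tuple s)); apply: finite_image; exact: finite_finset.
Qed.

Lemma finite_set_elems X (A : set X) : finite_set A -> exists s, A = elems s.
Proof.
elim/Peq: X A => X A /finite_seqP[s ->]; exists s.
elim: s => [|y s IH]; first by apply/seteqP; split.
rewrite elems_cons -IH; apply/seteqP; split=> x /=; rewrite inE.
  by case/orP => [/eqP|]; [left|right].
by case=> [->|->]; rewrite ?eqxx ?orbT.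
Qed.

Lemma elems_subU X (A B : set X) s : elems s `<=` A `|` B ->
  exists a b, [/\ elems a `<=` A, elems b `<=` B & elems s = elems a `|` elems b].
Proof.
elim: s => [|x s IH] sAB; first by exists [::], [::]; split=> //; rewrite setUid.
have [a [b [aA bB sab]]] := IH (fun y ys => sAB y (or_intror ys)).
have [xA|xB] := sAB x (or_introl erefl).
  exists (x :: a), b; split=> //; first by move=> y [<-//|/aA].
  by rewrite !elems_cons sab setUA.
exists a, (x :: b); split=> //; first by move=> y [<-//|/bB].
by rewrite !elems_cons sab setUCA.
Qed.

(** * Renaming of variables in formulas *)

Definition select X m n (v : n.-tuple X) (f : 'I_m -> 'I_n) : m.-tuple X :=
  [tuple tnth v (f i) | i < m].

Fixpoint rename_term L m n (f : 'I_m -> 'I_n) (t : term L m) : term L n :=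
  match t with
  | TVar i => TVar (f i)
  | TFun _ g ts => TFun g (fun i => rename_term f (ts i))
  end.

Definition up m n (f : 'I_m -> 'I_n) (i : 'I_m.+1) : 'I_n.+1 :=
  if unlift ord0 i is Some j then lift ord0 (f j) else ord0.

Fixpoint rename L m (phi : formula L m) : forall n, ('I_m -> 'I_n) -> formula L n :=
  match phi with
  | FBot _ => fun n f => FBot
  | FEq _ s t => fun n f => FEq (rename_term f s) (rename_term f t)
  | FRel _ _ r ts => fun n f => FRel r (fun i => rename_term f (ts i))
  | FImp _ phi psi => fun n f => FImp (rename phi f) (rename psi f)
  | FAll _ phi => fun n f => FAll (rename phi (up f))
  end.

Lemma teval_rename L (N : structure L) m n (f : 'I_m -> 'I_n) (t : term L m)
    (v : n.-tuple N) :
  teval v (rename_term f t) = teval (select v f) t.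
Proof.
elim: t => [i|k g ts IH] /=; first by rewrite tnth_mktuple.
by congr (ifun g); apply: eq_mktuple => i; exact: IH.
Qed.

Lemma select_up X m n (f : 'I_m -> 'I_n) (v : n.-tuple X) x :
  select [tuple of x :: v] (up f) = [tuple of x :: select v f].
Proof.
apply: eq_from_tnth => i; rewrite tnth_mktuple /up.
by case: unliftP => [j ->|->]; rewrite ?tnth0 // !tnthS tnth_mktuple.
Qed.

Lemma holds_rename L (N : structure L) m (phi : formula L m) n (f : 'I_m -> 'I_n)
    (v : n.-tuple N) :
  holds (rename phi f) v <-> holds phi (select v f).
Proof.
elim: phi n f v => {m} /= [|m s t|m k r ts|m phi IH psi IH'|m phi IH] n f v //.
- by rewrite !teval_rename.
- rewrite (_ : [tuple _ | _ < _] = [tuple teval (select v f) (ts i) | i < k]) //.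
  by apply: eq_mktuple => i; exact: teval_rename.
- by rewrite IH IH'.
- by split=> H x; have := H x; rewrite IH select_up.
Qed.

Definition FAnd L n (phi psi : formula L n) := FNot (FImp phi (FNot psi)).
Definition FEx L n (phi : formula L n.+1) := FNot (FAll (FNot phi)).

Lemma holds_FAnd L (N : structure L) n (phi psi : formula L n) (v : n.-tuple N) :
  holds (FAnd phi psi) v <-> holds phi v /\ holds psi v.
Proof.
split=> /= [H|[Hphi Hpsi] H]; last exact: H.
by split; apply: contrapT => Hn; apply: H.
Qed.

Lemma holds_FEx L (N : structure L) n (phi : formula L n.+1) (v : n.-tuple N) :
  holds (FEx phi) v <-> exists x, holds phi [tuple of x :: v].
Proof.
split=> /= [H|[x Hx] H]; last exact: H Hx.
by apply: contrapT => Hn; apply: H => x Hx; apply: Hn; exists x.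
Qed.

(* [g] lists the graph of a finite partial elementary relation. *)
Definition pel L (A B : structure L) (g : seq (A * B)) : Prop :=
  forall n (phi : formula L n) (v : n.-tuple (A * B)), tuple_in (elems g) v ->
    (holds phi [tuple of map fst v] <-> holds phi [tuple of map snd v]).

Definition swap X Y (p : X * Y) := (p.2, p.1).
(** The identity on [s] as a relation: [pel ((x, y) :: diag s)] thus says that [x] and [y] have the
    same type over [s]. *)
Definition diag X (s : seq X) := [seq (x, x) | x <- s].

Lemma map_fst_diag X (s : seq X) : map fst (diag s) = s.
Proof. by rewrite -map_comp map_id. Qed.

Lemma map_snd_diag X (s : seq X) : map snd (diag s) = s.
Proof. by rewrite -map_comp map_id. Qed.

Lemma elems_diag X (s : seq X) p : elems (diag s) p <-> p.1 = p.2 /\ elems s p.1.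
Proof.
rewrite elems_map; case: p => x y /=.
by split=> [[z zs [<- <-]]|[<- xs]] //; exists x.
Qed.

Section Pel.
Variable L : language.
Implicit Types A B C : structure L.

Lemma pel_sub A B (g h : seq (A * B)) : elems h `<=` elems g -> pel g -> pel h.
Proof. by move=> hg gP n phi v vh; apply: gP => i; exact/hg/vh. Qed.

Lemma pel_swap A B (g : seq (A * B)) : pel g -> pel (map (@swap _ _) g).
Proof.
move=> gP n phi v vg.
have -> : [tuple of map fst v] = [tuple of map snd [tuple of map (@swap _ _) v]].
  by apply: eq_from_tnth => i; rewrite !tnth_map.
have -> : [tuple of map snd v] = [tuple of map fst [tuple of map (@swap _ _) v]].
  by apply: eq_from_tnth => i; rewrite !tnth_map.
apply: iff_sym; apply: gP => i; rewrite tnth_map.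
by have := vg i; rewrite elems_map => -[[x y] xyg <-].
Qed.

Lemma pel_comp A B C (g : seq (A * B)) (h : seq (B * C)) (k : seq (A * C)) :
  pel g -> pel h ->
  (forall p, elems k p -> exists2 b, elems g (p.1, b) & elems h (b, p.2)) ->
  pel k.
Proof.
move=> gP hP ghk n phi v vk.
have /choice[u uP] i : exists b, elems g ((tnth v i).1, b) /\ elems h (b, (tnth v i).2).
  by have [b gb hb] := ghk _ (vk i); exists b.
have Eg := gP n phi [tuple ((tnth v i).1, u i) | i < n].
have Eh := hP n phi [tuple (u i, (tnth v i).2) | i < n].
have -> : [tuple of map fst v] = [tuple of map fst [tuple ((tnth v i).1, u i) | i < n]].
  by apply: eq_from_tnth => i; rewrite !tnth_map tnth_ord_tuple.
have -> : [tuple of map snd v] = [tuple of map snd [tuple (u i, (tnth v i).2) | i < n]].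
  by apply: eq_from_tnth => i; rewrite !tnth_map tnth_ord_tuple.
rewrite Eg => [|i]; last by rewrite tnth_mktuple; case: (uP i).
rewrite -Eh => [|i]; last by rewrite tnth_mktuple; case: (uP i).
suff -> : [tuple of map snd [tuple ((tnth v i).1, u i) | i < n]] =
  [tuple of map fst [tuple (u i, (tnth v i).2) | i < n]] by [].
by apply: eq_from_tnth => i; rewrite !tnth_map tnth_ord_tuple.
Qed.

Lemma pel_diag A (s : seq A) : pel (diag s).
Proof.
move=> n phi v vs; suff -> : [tuple of map fst v] = [tuple of map snd v] by [].
by apply: eq_from_tnth => i; rewrite !tnth_map; have /elems_diag[] := vs i.
Qed.

(** Any tuple from [g] is a selection from the listing of [g], so renaming reduces all arities to
    [size g]. One implication is enough, as it also applies to negations. *)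
Lemma pel_enum A B (g : seq (A * B)) :
  (forall phi : formula L (size g), holds phi [tuple of map fst (in_tuple g)] ->
     holds phi [tuple of map snd (in_tuple g)]) -> pel g.
Proof.
move=> gP n phi v vg.
have /choice[f fP] i : exists j, tnth (in_tuple g) j = tnth v i.
  by have := vg i; rewrite (elems_tnth (in_tuple g)) => -[j _ <-]; exists j.
have E C (c : A * B -> C) : [tuple of map c v] =
    select [tuple of map c (in_tuple g)] f.
  by apply: eq_from_tnth => i; rewrite !tnth_map tnth_ord_tuple fP.
rewrite !E -!holds_rename; split; first exact: gP.
move=> H; apply: contrapT => Hn; exact: gP (FNot (rename phi f)) Hn H.
Qed.

Lemma pel_cons A B (g : seq (A * B)) d d' :
  (forall phi : formula L (size g).+1,
     holds phi [tuple of d :: [tuple of map fst (in_tuple g)]] ->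
     holds phi [tuple of d' :: [tuple of map snd (in_tuple g)]]) ->
  pel ((d, d') :: g).
Proof.
move=> gP; apply: pel_enum => phi.
have -> : [tuple of map fst (in_tuple ((d, d') :: g))] =
  [tuple of d :: [tuple of map fst (in_tuple g)]] by exact: val_inj.
have -> : [tuple of map snd (in_tuple ((d, d') :: g))] =
  [tuple of d' :: [tuple of map snd (in_tuple g)]] by exact: val_inj.
exact: gP.
Qed.

Lemma pel_holds A B (g h : seq (A * B)) (phi : formula L (size h)) :
  pel g -> elems h `<=` elems g ->
  holds phi [tuple of map fst (in_tuple h)] <->
  holds phi [tuple of map snd (in_tuple h)].
Proof. by move=> gP hg; apply: gP; apply/tuple_inP. Qed.

Lemma pel_fun A B (g : seq (A * B)) x y y' :
  pel g -> elems g (x, y) -> elems g (x, y') -> y = y'.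
Proof.
move=> gP gy gy'.
have [] := gP 2 (FEq (TVar ord0) (TVar (lift ord0 ord0))) [tuple (x, y); (x, y')].
  by apply/tuple_inP => p [<-|[<-|]].
by move=> H _; exact: H.
Qed.

(* The family [U] is the base of a filter; a realized type consists of the
   formulas over [w] which hold on some member of it. *)
Definition rich A := forall n (w : n.-tuple A) I (U : I -> set A), inhabited I ->
  (forall i j, exists k, U k `<=` U i `&` U j) -> (forall i, U i !=set0) ->
  exists x, forall phi : formula L n.+1,
    (exists i, forall y, U i y -> holds phi [tuple of y :: w]) ->
    holds phi [tuple of x :: w].

(** Finitely many formulas, each true throughout some member of the base, hold together on a smaller
    member, which is nonempty; so all such formulas over [P] form a type. *)
Lemma saturated_base kappa A (P : set A) I (U : I -> set A) :
  saturated kappa A -> small kappa P -> inhabited I ->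
  (forall i j, exists k, U k `<=` U i `&` U j) -> (forall i, U i !=set0) ->
  exists x, forall f : pformula A, pover P f -> (exists i, U i `<=` pholds f) ->
    pholds f x.
Proof.
move=> satA smallP [i0] Udir Un0.
have [|f []//|s sp|x xP] := satA P (fun f => pover P f /\ exists i, U i `<=` pholds f).
- exact: smallP.
- have [i iP] : exists i, forall f, List.In f s -> U i `<=` pholds f.
    elim: s sp => [|f s IH] sp; first by exists i0.
    have [i iP] := IH (fun h hs => sp h (or_intror hs)).
    have [_ [j jP]] := sp f (or_introl erefl).
    have [k kij] := Udir i j; exists k => h [<-|hs] y /kij[Ui Uj]; first exact: jP.
    exact: iP hs _ Ui.
  by have [x Ux] := Un0 i; exists x => f fs; exact: iP.
by exists x => f Pf Hf; exact: xP.
Qed.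

Lemma saturated_rich kappa A :
  [set: nat] #<= [set: kappa] -> saturated kappa A -> rich A.
Proof.
move=> kinf satA n w I U I0 Udir Un0.
have [|x xP] := @saturated_base kappa A (elems w) I U satA _ I0 Udir Un0.
  by apply: small_finite => //; exact: finite_elems.
exists x => phi phiP; apply: (xP (PFormula phi w)) => //.
by apply/tuple_inP.
Qed.

(** Each formula true of [d] over the domain of [g] has its existential closure preserved by [g], so
    the corresponding solution sets over the range are the base of a filter. *)
Lemma rich_ext A B (g : seq (A * B)) d : rich B -> pel g ->
  exists d', pel ((d, d') :: g).
Proof.
move=> richB gP; pose v := [tuple of map fst (in_tuple g)].
pose w := [tuple of map snd (in_tuple g)].
pose tp (phi : formula L (size g).+1) := holds phi [tuple of d :: v].
have [|||d' d'P] := richB _ w _ (fun i : {phi | tp phi} => [set y | holds (sval i) [tuple of y :: w]]).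
- have top : holds (FNot FBot) [tuple of d :: v] by [].
  by exists; exists (FNot FBot).
- move=> [phi phid] [psi psid].
  have phipsi : holds (FAnd phi psi) [tuple of d :: v] by apply/holds_FAnd.
  by exists (exist tp _ phipsi) => y /= /holds_FAnd.
- move=> [phi phid] /=.
  have : holds (FEx phi) v by apply/holds_FEx; exists d.
  by rewrite (pel_holds _ gP) // => /holds_FEx.
exists d'; apply: pel_cons => phi phid; apply: d'P.
by exists (exist tp _ phid).
Qed.

Lemma rich_ext_list A B (g : seq (A * B)) (s : seq A) : rich B -> pel g ->
  exists h, map fst h = s /\ pel (h ++ g).
Proof.
move=> richB gP; elim: s => [|d s [h [hs hP]]]; first by exists [::].
have [d' d'P] := rich_ext d richB hP.
by exists ((d, d') :: h); rewrite /= hs.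
Qed.

(** Sentences have the same truth value in all models of [T]. Extensions from one model to another
    start from this empty relation. *)
Lemma complete_pel_nil (T : theory L) A B :
  complete T -> models A T -> models B T -> pel ([::] : seq (A * B)).
Proof.
move=> [_ cT] AT BT; apply: pel_enum => phi.
have E C (t : (size ([::] : seq (A * B))).-tuple C) : t = [tuple] by exact: tuple0.
rewrite (E A [tuple of _]) (E B [tuple of _]) => Aphi.
have [H|H] := cT phi; first exact: H.
by have := H A AT Aphi.
Qed.

End Pel.

(** * Transfer of the matroid *)

Section Transfer.
Variables (L : language) (M : structure L) (cl : set M -> set M).

Lemma transfer_mono (N : structure L) (X Y : set N) a :
  X `<=` Y -> transfer cl X a -> transfer cl Y a.
Proof.
by move=> XY [n [phi [c [? cX ?]]]]; exists n, phi, c; split=> // i; exact/XY/cX.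
Qed.

Lemma transfer_finitary (N : structure L) (X : set N) a : transfer cl X a ->
  exists2 s, elems s `<=` X & transfer cl (elems s) a.
Proof.
move=> [n [phi [c [? /tuple_inP cX ?]]]]; exists c => //.
by exists n, phi, c; split=> //; apply/tuple_inP.
Qed.

(** Narrowness is a property of the formula, decided in [M]; so the formula that puts [a] in the
    closure serves again for [b]. *)
Lemma transfer_pel (A B : structure L) (g : seq (A * B)) (X : set (A * B)) a b :
  pel g -> X `<=` elems g -> elems g (a, b) ->
  transfer cl (fst @` X) a -> transfer cl (snd @` X) b.
Proof.
move=> gP Xg gab [n [phi [c [phin cX phia]]]].
have /choice[u uP] i : exists p, X p /\ p.1 = tnth c i.
  by have [p Xp pc] := cX i; exists p.
have {}phia : holds phi [tuple of map fst [tuple of (a, b) :: [tuple u i | i < n]]].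
  suff -> : [tuple of map fst [tuple of (a, b) :: [tuple u i | i < n]]] =
    [tuple of a :: c] by [].
  apply: val_inj => /=; congr cons; rewrite -map_comp.
  rewrite -[RHS](map_tnth_enum c) ; apply: eq_map => i /=; exact: (uP i).2.
exists n, phi, [tuple of map snd [tuple u i | i < n]]; split=> // [i|].
  by rewrite tnth_map tnth_mktuple; exists (u i) => //; exact: (uP i).1.
move: phia; rewrite gP; last first.
  apply/tuple_inP => p [<-//|pu].
  have : elems [tuple u i | i < n] p by [].
  by rewrite elems_tnth => -[i _ <-]; rewrite tnth_mktuple; exact/Xg/(uP i).1.
suff -> : [tuple of map snd [tuple of (a, b) :: [tuple u i | i < n]]] =
    [tuple of b :: [tuple of map snd [tuple u i | i < n]]] by [].
exact: val_inj.
Qed.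

Lemma transfer_pel_list (A B : structure L) (g h : seq (A * B)) a b :
  pel g -> elems h `<=` elems g -> elems g (a, b) ->
  transfer cl (elems (map fst h)) a <-> transfer cl (elems (map snd h)) b.
Proof.
move=> gP hg gab; rewrite !elems_map; split; first exact: transfer_pel hg gab.
have := transfer_pel (pel_swap gP) (X := @swap _ _ @` elems h) (a := b) (b := a).
rewrite !image_comp; apply.
  by rewrite elems_map; exact: image_subset.
by rewrite elems_map; exists (a, b).
Qed.
End Transfer.

(** * Matroids *)

Section Matroid.
Variables (X : Type) (c : set X -> set X).
Hypothesis cP : matroid c.
Implicit Types (A D Y Z : set X) (s t : seq X).

Lemma matroid_ext A : A `<=` c A.
Proof. by have [ext _ _ _ _] := cP; exact: ext. Qed.

Lemma matroid_mono A D x : A `<=` D -> c A x -> c D x.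
Proof. by have [_ mono _ _ _] := cP; move=> /mono; exact. Qed.

Lemma matroid_sub A D x : A `<=` c D -> c A x -> c D x.
Proof.
by have [_ _ idem _ _] := cP => AD Ax; rewrite -(idem D); exact: matroid_mono Ax.
Qed.

Lemma matroid_finitary A x : c A x -> exists2 s, elems s `<=` A & c (elems s) x.
Proof.
have [_ _ _ fin _] := cP; rewrite fin => -[_ [/[swap] /finite_set_elems[s ->] sA] sx].
by exists s.
Qed.

Lemma matroid_exchange A x y : c (A `|` [set y]) x -> ~ c A x -> c (A `|` [set x]) y.
Proof. by have [_ _ _ _ exch] := cP => Ax nAx; exact: exch. Qed.

(** Finite character is applied to the entries of [s] one by one, and the elements of [F] that they
    need are collected. *)
Lemma matroid_fin_elems (F Y : set X) s : elems s `<=` c (F `|` Y) ->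
  exists2 f, elems f `<=` F & elems s `<=` c (elems f `|` Y).
Proof.
elim: s => [|x s IH] sFY; first by exists [::].
have [f fF sfY] := IH (fun y ys => sFY y (or_intror ys)).
have [t tFY tx] := matroid_finitary (sFY x (or_introl erefl)).
have [t1 [t2 [t1F t2Y tE]]] := elems_subU tFY.
exists (t1 ++ f); first by rewrite elems_cat => y [/t1F|/fF].
rewrite elems_cat => y [<-|/sfY]; last first.
  by apply: matroid_mono => z [fz|Yz]; [left; right|right].
by move: tx; apply: matroid_mono; rewrite tE => z [tz|/t2Y Yz]; [left; left|right].
Qed.

(* Independence of a list over [D], its last entry coming first. *)
Fixpoint seq_indep D s : Prop :=
  if s is x :: s' then ~ c (D `|` elems s') x /\ seq_indep D s' else True.

Lemma seq_indep_sub D A s : A `<=` D -> seq_indep D s -> seq_indep A s.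
Proof.
move=> AD; elim: s => //= x s IH [nDx /IH As]; split=> // Asx; apply: nDx.
by move: Asx; apply: matroid_mono; exact: setSU.
Qed.

(** If an entry [y] of [s] helped to put [x] in the closure, exchange would put [y] in the closure
    of [x], [Z] and the entries after it, hence of [D] and these entries, against independence. *)
Lemma seq_indep_separate D Z s x :
  seq_indep D s -> Z `<=` D -> D x -> c (Z `|` elems s) x -> c Z x.
Proof.
move=> + ZD Dx; elim: s => [_|y s IH [nDy Ds]].
  by apply: matroid_mono => z [].
rewrite elems_cons setUCA setUC => Zx; apply: IH => //.
apply: contrapT => nZx; apply: nDy.
have := matroid_exchange Zx nZx; apply: matroid_mono.
by move=> z [[/ZD Dz|sz]|->]; [left|right|left].
Qed.

Lemma seq_indep_add D s z :
  ~ c (D `|` elems s) z -> seq_indep D s -> seq_indep (D `|` [set z]) s.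
Proof.
elim: s => //= x s IH nDz [nDx Ds]; split.
  rewrite setUAC => Dx; apply: nDz; have := matroid_exchange Dx nDx.
  by rewrite elems_cons; apply: matroid_mono => y [[Dy|sy]|->];
    [left|right; right|right; left].
apply: IH Ds => Dz; apply: nDz; move: Dz; apply: matroid_mono.
by rewrite elems_cons; apply: setUS => y; right.
Qed.

(** Steinitz exchange: the entry dropped, if any, is the first whose successors do not have [z] in
    their closure over [D]. Earlier entries stay independent because [z] lies in the closure over
    [D] of the entries that follow them. *)
Lemma seq_indep_remove D s z : seq_indep D s -> exists t,
  [/\ elems t `<=` elems s, (size s <= (size t).+1)%N & seq_indep (D `|` [set z]) t].
Proof.
elim: s => [_|x s IH /= [nDx Ds]]; first by exists [::]; split.
have [Dz|nDz] := pselect (c (D `|` elems s) z); last first.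
  by exists s; split=> [y ys|//|]; [right|exact: seq_indep_add].
have [t [ts st Dt]] := IH Ds; exists (x :: t); split=> //.
  by move=> y [->|/ts]; [left|right].
split=> // Dx; apply: nDx; move: Dx; apply: matroid_sub.
move=> y [[Dy|->]|/ts sy] //; apply: matroid_ext; [by left|by right].
Qed.

(** Induction on [t]: moving one entry of [t] into [D] costs at most one entry of [s]. *)
Lemma seq_indep_size D s t :
  seq_indep D s -> elems s `<=` c (D `|` elems t) -> (size s <= size t)%N.
Proof.
elim: t D s => [|y t IH] D s Ds sDt.
  case: s Ds sDt => //= x s [nDx _] sDt; exfalso; apply: nDx.
  have := sDt x (or_introl erefl); apply: matroid_mono.
  by move=> z [|[]]; left.
have [u [us su Du]] := seq_indep_remove y Ds.
apply: leq_trans su _; rewrite ltnS; apply: IH Du _.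
by move=> x /us/sDt; rewrite elems_cons setUA.
Qed.

Lemma seq_indep_cat D s t :
  seq_indep (D `|` elems t) s -> seq_indep D t -> seq_indep D (s ++ t).
Proof.
elim: s => //= x s IH [nDx Ds] Dt; split; last exact: IH.
by rewrite elems_cat (setUC (elems s)) setUA.
Qed.

Lemma seq_indep_notin D s x : seq_indep D s -> elems s x -> ~ c D x.
Proof.
elim: s => //= y s IH [nDy Ds] [<-|sx]; last exact: IH.
by move=> Dy; apply: nDy; move: Dy; apply: matroid_mono; left.
Qed.

Lemma seq_indep_basis D s t : seq_indep D t -> exists u,
  [/\ elems t `<=` elems u, elems u `<=` elems t `|` elems s,
      seq_indep D u & elems s `<=` c (D `|` elems u)].
Proof.
move=> Dt; elim: s => [|x s [u [tu uts Du su]]].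
  by exists t; split=> // y; left.
have [ux|nux] := pselect (c (D `|` elems u) x).
  exists u; split=> //; last by move=> y [<-|/su].
  by move=> y /uts[ty|sy]; [left|right; right].
exists (x :: u); split=> //.
- by move=> y /tu; right.
- by move=> y [<-|/uts[ty|sy]]; [right; left|left|right; right].
- rewrite elems_cons => y [<-|/su]; first by apply: matroid_ext; right; left.
  by apply: matroid_mono; apply: setUS => z; right.
Qed.

Lemma matroid_localize (F : set X) : matroid (fun A => c (A `|` F)).
Proof.
split.
- by move=> A x Ax; apply: matroid_ext; left.
- by move=> A D AD x; apply: matroid_mono; exact: setSU.
- move=> A; apply/seteqP; split; last by move=> x Ax; apply: matroid_ext; left.
  by move=> x; apply: matroid_sub => y [//|Fy]; apply: matroid_ext; right.
- move=> A; apply/seteqP; split=> [x /matroid_finitary[s sAF sx]|x [B [BA _]]].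
    have [a [b [aA bF sE]]] := elems_subU sAF.
    exists (elems a); first by split=> //; exact: finite_elems.
    by move: sx; apply: matroid_mono; rewrite sE; exact: setUS.
  by apply: matroid_mono; exact: setSU.
- move=> A x y [] /=; rewrite (setUAC _ [set _]) => Ax nAx.
  by rewrite setUAC; exact: matroid_exchange.
Qed.

End Matroid.

(** * Models of [T]: matroid axioms and Existence for the transferred closure *)

Section Model.
Variables (kappa : Type) (L : language) (T : theory L).
Variables (M : structure L) (cl : set M -> set M).
Hypotheses (kinf : [set: nat] #<= [set: kappa]) (completeT : complete T).
Hypotheses (MP : monster kappa T M) (clP : existential_matroid kappa cl).

Let MT : models M T. Proof. by case: MP. Qed.
Let richM : rich M. Proof. by case: MP => _ satM _; exact: saturated_rich satM. Qed.
Let matroid_cl : matroid cl. Proof. by case: clP => -[]. Qed.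

Lemma transfer_id (X : set M) : transfer cl X = cl X.
Proof. by case: clP => -[_ ->]. Qed.

Variable N : structure L.
Hypotheses (NT : models N T) (richN : rich N).
Local Notation c := (@transfer L M cl N).

(** The empty relation is extended by richness of [M]. As each matroid axiom comes down to finitely
    many elements, it can be checked on their copies in [M]. *)
Lemma pel_into_monster (s : seq N) : exists2 g : seq (N * M), map fst g = s & pel g.
Proof.
have [g [gs gP]] := rich_ext_list s richM (complete_pel_nil completeT NT MT).
by exists g => //; rewrite -(cats0 g).
Qed.

Lemma transfer_into (g h : seq (N * M)) a b :
  pel g -> elems h `<=` elems g -> elems g (a, b) ->
  c (elems (map fst h)) a <-> cl (elems (map snd h)) b.
Proof. by move=> gP hg gab; rewrite (transfer_pel_list cl gP hg gab) transfer_id. Qed.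

Lemma transfer_ext (X : set N) : X `<=` c X.
Proof.
move=> a Xa; have [g gE gP] := pel_into_monster [:: a].
case: g gE gP => [|[b m] [|p g]] //= ba gP.
case: ba gP => -> gP.
apply: (@transfer_mono _ _ _ _ (elems [:: a])); first by move=> z [<-|].
apply/(transfer_into gP (h := [:: (a, m)])) => //; first by left.
by apply: matroid_ext => //; left.
Qed.

Lemma transfer_idem (X : set N) : c (c X) = c X.
Proof.
apply/seteqP; split; last exact: transfer_ext.
move=> a /transfer_finitary[t tX ta].
have [s sX ts] : exists2 s, elems s `<=` X & elems t `<=` c (elems s).
  elim: t tX {ta} => [|x t IH] tX; first by exists [::].
  have [s sX ts] := IH (fun y ty => tX y (or_intror ty)).
  have [u uX ux] := transfer_finitary (tX x (or_introl erefl)).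
  exists (s ++ u); first by rewrite elems_cat => y [/sX|/uX].
  rewrite elems_cat => y [<-|/ts yc].
    by apply: transfer_mono ux => z; right.
  by apply: transfer_mono yc => z; left.
apply: (transfer_mono sX).
(* With [s], [t] and [a] copied into [M], idempotence of [cl] applies to the copies. *)
have [hs hsE hsP] := pel_into_monster s.
have [ht [htE htP]] := rich_ext_list t richM hsP.
have [m mP] := rich_ext a richM htP.
have sub1 : elems hs `<=` elems ((a, m) :: ht ++ hs).
  by rewrite elems_cons elems_cat => y; right; right.
have sub2 : elems ht `<=` elems ((a, m) :: ht ++ hs).
  by rewrite elems_cons elems_cat => y; right; left.
rewrite -hsE; apply/(transfer_into mP) => //; first by left.
have : cl (elems (map snd ht)) m.
  by apply/(transfer_into mP sub2 (a := a)); [left|rewrite htE].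
apply: matroid_sub => //; rewrite elems_map => _ [[x y] hxy <-] /=.
apply/(transfer_into mP sub1 (sub2 _ hxy)); rewrite hsE; apply: ts.
by rewrite -htE elems_map; exists (x, y).
Qed.

Lemma transfer_exchange : exchange c.
Proof.
move=> X a y [/transfer_finitary[s sXy sa] nXa].
have [s1 [s2 [s1X s2y sE]]] := elems_subU sXy.
have [hs hsE hsP] := pel_into_monster s1.
have [y' yP] := rich_ext y richM hsP.
have [a' aP] := rich_ext a richM yP.
have sub1 : elems hs `<=` elems [:: (a, a'), (y, y') & hs] by move=> z; right; right.
have Ea : elems [:: (a, a'), (y, y') & hs] (a, a') by left.
have Ey : elems [:: (a, a'), (y, y') & hs] (y, y') by right; left.
have : cl (elems (map snd hs) `|` [set a']) y'.
  apply: matroid_exchange => //.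
    rewrite setUC -elems_cons.
    apply/(transfer_into aP (h := (y, y') :: hs) _ Ea); first by move=> z; right.
    apply: transfer_mono sa; rewrite /= hsE sE elems_cons => z [s1z|/s2y]; first by right.
    by left.
  move=> /(transfer_into aP sub1 Ea); rewrite hsE => s1a; apply: nXa.
  exact: transfer_mono s1a.
rewrite setUC -elems_cons.
move=> /(transfer_into aP (h := (a, a') :: hs) _ Ey) H.
have {}H : c (elems (map fst ((a, a') :: hs))) y.
  by apply: H => z [<-|]; [left|right; right].
apply: transfer_mono H; rewrite /= hsE elems_cons => z [->|/s1X]; first by right.
by left.
Qed.

Lemma transfer_matroid : matroid c.
Proof.
split.
- exact: transfer_ext.
- by move=> X Y XY x; exact: transfer_mono.
- exact: transfer_idem.
- move=> X; apply/seteqP; split=> [x /transfer_finitary[s sX sx]|x [A [AX _]]].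
    by exists (elems s) => //; split=> //; exact: finite_elems.
  exact: transfer_mono.
- exact: transfer_exchange.
Qed.

Lemma same_type_pel (s : seq M) a b : same_type (elems s) a b -> pel ((a, b) :: diag s).
Proof.
move=> ab; apply: pel_cons => phi.
pose v := [tuple of map fst (in_tuple (diag s))].
pose w := [tuple of map snd (in_tuple (diag s))]; rewrite -/v -/w.
have -> : w = v.
  by apply: val_inj; rewrite /= map_fst_diag map_snd_diag.
apply: (ab (PFormula phi v) _).1; apply/tuple_inP.
by rewrite /= map_fst_diag.
Qed.

(** Existence is brought from [M] to [N] for finite sets: [d] goes to some [d1] along [g], then to a
    copy [m1] in [M], is replaced there by [m2] of the same type over the copied range but outside
    the closure of the copies of that range and [u], and comes back as [d2]. *)
Lemma pel_generic (g : seq (N * N)) (u : seq N) d :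
  pel g -> ~ c (elems (map fst g)) d ->
  exists2 d', pel ((d, d') :: g) & ~ c (elems (map snd g ++ u)) d'.
Proof.
move=> gP nd; have [d1 d1P] := rich_ext d richN gP.
have {nd}nd1 : ~ c (elems (map snd g)) d1.
  by move=> H; apply: nd; apply: (transfer_pel_list cl d1P _ _).2 H; [right|left].
have [hu huE huP] := pel_into_monster u.
have [hs [hsE hsP]] := rich_ext_list (map snd g) richM huP.
have [m1 m1P] := rich_ext d1 richM hsP.
have nm1 : ~ cl (elems (map snd hs)) m1.
  rewrite -(transfer_into m1P (a := d1)) ?hsE //; last by left.
  by move=> z; rewrite elems_cons elems_cat; right; left.
have small_elems (s : seq M) : small kappa (elems s).
  by apply: small_finite kinf _; exact: finite_elems.
have [m2 [m12 nm2]] : exists m2, same_type (elems (map snd hs)) m1 m2 /\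
    ~ cl (elems (map snd hs) `|` elems (map snd hu)) m2.
  by case: clP => _ ex _; exact: ex.
have [d2 d2P] := rich_ext m2 richN (pel_swap hsP).
have P1 : pel ((d1, m2) :: hs).
  apply: (pel_comp m1P (same_type_pel m12)) => -[x y] [[<- <-]|hxy].
    by exists m1; left.
  exists y; first by right; rewrite elems_cat; left.
  by right; apply/elems_diag; split=> //; rewrite elems_map; exists (x, y).
have P2 : pel ((d1, d2) :: diag (map snd g)).
  apply: (pel_comp P1 d2P) => -[x y] [[<- <-]|/elems_diag[/= <-]].
    by exists m2; left.
  rewrite -hsE elems_map => -[[x' m] hxm /= <-].
  exists m; first by right.
  right; change (elems (map (@swap _ _) (hs ++ hu)) (m, x')).
  by rewrite elems_map elems_cat; exists (x', m) => //; left.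
exists d2.
  apply: (pel_comp d1P P2) => -[x y] [[<- <-]|gxy].
    by exists d1; left.
  exists y; first by right.
  by right; apply/elems_diag; split=> //; rewrite elems_map; exists (x, y).
rewrite -elems_cat -map_cat in nm2 => H; apply: nm2.
have := transfer_pel_list cl d2P (h := map (@swap _ _) (hs ++ hu)) (a := m2) (b := d2).
rewrite -!map_comp transfer_id => E; apply/E; [by move=> z; right|by left|].
by rewrite [X in elems X](_ : _ = map snd g ++ u) // map_cat hsE huE.
Qed.

(** If [x] were outside the closure of [s], some conjugate of it over [s] would be outside the
    closure of [s] and [x], hence different from [x]. *)
Lemma transfer_dcl (s : seq N) x :
  (forall x', pel ((x, x') :: diag s) -> x' = x) -> c (elems s) x.
Proof.
move=> xP; apply: contrapT => nx.
have [|x' x'P nx'] := @pel_generic (diag s) [:: x] x (@pel_diag L N s).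
  by rewrite map_fst_diag.
apply: nx'; rewrite (xP _ x'P); apply: transfer_ext.
by rewrite elems_cat; right; left.
Qed.

End Model.

(** * Polynomials over an integral domain *)

Lemma mem_In (X : eqType) (s : seq X) x : x \in s <-> List.In x s.
Proof.
elim: s => //= y s IH; rewrite inE; split=> [/orP[/eqP->|/IH]|[->|/IH ->]].
- by left.
- by right.
- by rewrite eqxx.
- by rewrite orbT.
Qed.

Lemma NoDup_uniq (X : eqType) (s : seq X) : List.NoDup s -> uniq s.
Proof.
elim: s => //= x s IH /List.NoDup_cons_iff[xs /IH ->]; rewrite andbT.
by apply/negP => /mem_In.
Qed.

(** A nonzero difference would have more roots than its degree allows. *)
Lemma horner_Poly_inj (D : idomainType) (s t bs : seq D) :
  size s = size t -> (size s <= size bs)%N -> uniq bs ->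
  {in bs, forall b, (Poly s).[b] = (Poly t).[b]}%R -> s = t.
Proof.
move=> st sbs bsU stE; pose p := (Poly s - Poly t)%R.
have p0 : p = 0%R.
  apply/eqP/negPn/negP => p0; have : (size p <= size s)%N.
    apply: leq_trans (size_polyD _ _) _.
    by rewrite size_polyN geq_max size_Poly /= st size_Poly.
  apply/negP; rewrite -ltnNge; apply: leq_ltn_trans sbs _.
  apply: max_poly_roots p0 _ bsU; apply/allP => b bbs.
  by rewrite /root hornerD hornerN stE // GRing.subrr.
apply: (@eq_from_nth D 0%R) => // i _.
by rewrite -(coef_Poly s) -(coef_Poly t) (GRing.subr0_eq p0).
Qed.

Section Domain.
Variables (R : Type) (zero one : R) (opp : R -> R) (add mul : R -> R -> R).
Hypothesis domR : integral_domain zero one opp add mul.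

(** An alias of the carrier that remembers the proof of the axioms, so that ring instances can be
    attached to it. *)
Definition domain_of of integral_domain zero one opp add mul : Type := R.
Local Notation D := (domain_of domR).

Let addA : associative (add : D -> D -> D). Proof. by have [[]] := domR. Qed.
Let addC : commutative (add : D -> D -> D). Proof. by have [[]] := domR. Qed.
Let add0 : left_id (zero : D) add. Proof. by have [[]] := domR. Qed.
Let addN : left_inverse (zero : D) opp add. Proof. by have [[]] := domR. Qed.

HB.instance Definition _ := gen_eqMixin D.
HB.instance Definition _ := gen_choiceMixin D.
HB.instance Definition _ := GRing.isZmodule.Build D addA addC add0 addN.

Let mulA : associative (mul : D -> D -> D). Proof. by have [_ [[]]] := domR. Qed.
Let mulC : commutative (mul : D -> D -> D). Proof. by have [_ [[]]] := domR. Qed.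
Let mul1 : left_id (one : D) mul. Proof. by have [_ [[]]] := domR. Qed.
Let mulDl : left_distributive (mul : D -> D -> D) +%R.
Proof. by have [_ [[]]] := domR. Qed.
Let one0 : (one : D) != 0%R. Proof. by have [_ [_ [ne _]]] := domR; apply/eqP. Qed.

HB.instance Definition _ :=
  GRing.Zmodule_isComNzRing.Build D mulA mulC mul1 mulDl one0.

(** The interface of unit rings asks for an inverse function that is the identity off the units; on
    a unit, an inverse is chosen. *)
Let unitD (x : D) := `[< exists y, mul y x = one >].
Let invD (x : D) : D := if pselect (exists y, mul y x = one) is left e
  then projT1 (cid e) else x.

Let mulVx : {in unitD, left_inverse (1%R : D) invD *%R}.
Proof.
move=> x /asboolP ux; rewrite /invD; case: pselect => // e.
exact: (projT2 (cid e)).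
Qed.
Let unitPl (x y : D) : (y * x)%R = 1%R -> unitD x.
Proof. by move=> yx; apply/asboolP; exists y. Qed.
Let invD_out : {in [predC unitD], invD =1 id}.
Proof. by move=> x /asboolP ux; rewrite /invD; case: pselect. Qed.

HB.instance Definition _ :=
  GRing.ComNzRing_hasMulInverse.Build D mulVx unitPl invD_out.

Let mul_eq0 (x y : D) : (x * y)%R = 0%R -> (x == 0%R) || (y == 0%R).
Proof.
have [_ [_ [_ integ]]] := domR; move=> /integ xy0; apply/orP.
by case: xy0 => xy0; [left|right]; apply/eqP.
Qed.

HB.instance Definition _ := GRing.ComUnitRing_isIntegral.Build D mul_eq0.

(** Horner's scheme, with the constant term at the head of the list. *)
Definition eval_poly (s : seq R) (b : R) : R :=
  foldr (fun a e => add (mul e b) a) zero s.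

(** The constant term is found by a subtraction, whatever the other coefficients are. *)
Lemma eval_poly_head (x b : R) (s : seq R) : exists a, eval_poly (a :: s) b = x.
Proof.
exists ((x : D) - (eval_poly s b : D) * (b : D))%R => /=.
exact: (GRing.subrKC ((eval_poly s b : D) * (b : D))%R).
Qed.

Lemma eval_poly_inj (s t bs : seq R) : size s = size t -> (size s <= size bs)%N ->
  List.NoDup bs -> (forall b, List.In b bs -> eval_poly s b = eval_poly t b) -> s = t.
Proof.
move=> st sbs bsU stE.
have evalE (u : seq D) (b : D) : (Poly u).[b]%R = eval_poly u b.
  by rewrite horner_Poly; elim: u => //= a u ->.
apply: (@horner_Poly_inj D s t bs) => //; first exact: (@NoDup_uniq D).
by move=> b /(@mem_In D) /stE; rewrite -!evalE.
Qed.

End Domain.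

(** * The language of pairs *)

Section Embed.
Variable L : language.
Local Notation L2 := (pair_language L).

Fixpoint embed_term n (t : term L n) : term L2 n :=
  match t with
  | TVar i => TVar i
  | TFun k f ts => @TFun L2 n k f (fun i => embed_term (ts i))
  end.

(** The language of pairs adds no function symbol, so its terms are terms of [L]; atomic formulas of
    pairs can thus be read in the reduct. *)
Fixpoint restrict_term n (t : term L2 n) : term L n :=
  match t with
  | TVar i => TVar i
  | TFun k f ts => @TFun L n k f (fun i => restrict_term (ts i))
  end.

Fixpoint embed n (phi : formula L n) : formula L2 n :=
  match phi with
  | FBot _ => FBot
  | FEq _ s t => FEq (embed_term s) (embed_term t)
  | FRel _ _ r ts => FRel (OldRel r : rsym L2 _) (fun i => embed_term (ts i))
  | FImp _ phi psi => FImp (embed phi) (embed psi)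
  | FAll _ phi => FAll (embed phi)
  end.

Variable N : structure L2.

Lemma teval_embed n (v : n.-tuple N) (t : term L n) :
  teval v (embed_term t) = @teval L (reduct N) n v t.
Proof.
elim: t => [//|k f ts IH] /=; apply: (congr1 (@ifun L2 N k f)).
by apply: eq_mktuple => i; exact: IH.
Qed.

Lemma teval_restrict n (v : n.-tuple N) (t : term L2 n) :
  @teval L (reduct N) n v (restrict_term t) = teval v t.
Proof.
elim: t => [//|k f ts IH] /=; apply: (congr1 (@ifun L2 N k f)).
by apply: eq_mktuple => i; exact: IH.
Qed.

Lemma holds_embed n (phi : formula L n) (v : n.-tuple N) :
  holds (embed phi) v <-> @holds L (reduct N) n phi v.
Proof.
elim: phi v => {n} /= [|n s t|n k r ts|n phi IH psi IH'|n phi IH] v //.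
- by rewrite !teval_embed.
- rewrite (_ : [tuple _ | _ < _] = [tuple @teval L (reduct N) n v (ts i) | i < k]) //.
  by apply: eq_mktuple => i; exact: teval_embed.
- by rewrite IH IH'.
- by split=> H x; have := H x; rewrite IH.
Qed.

Lemma rich_reduct : rich N -> rich (reduct N).
Proof.
move=> richN n w I U I0 Udir Un0; have [x xP] := richN n w I U I0 Udir Un0.
exists x => phi [i iP]; apply/holds_embed; apply: xP; exists i => y Uy.
by apply/holds_embed; exact: iP.
Qed.

Definition FP n : formula L2 n.+1 := @FRel L2 n.+1 1 PredP (fun=> TVar ord0).

Lemma holds_FP n (v : n.-tuple N) x : holds (FP n) [tuple of x :: v] <-> predP N x.
Proof.
rewrite /predP /=.
by rewrite (_ : [tuple _ | _ < 1] = [tuple x]) //; apply: eq_from_tnth => i;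
  rewrite tnth_mktuple tnth0 (tnth_nth x) ord1.
Qed.

Fixpoint exP m n : formula L2 (m + n) -> formula L2 n :=
  match m with
  | 0 => id
  | m.+1 => fun phi => @exP m n (FEx (FAnd (FP (m + n)) phi))
  end.

Lemma holds_exP m n (phi : formula L2 (m + n)) (v : n.-tuple N) :
  holds (exP phi) v <->
  exists z : m.-tuple N, tuple_in (predP N) z /\ holds phi [tuple of z ++ v].
Proof.
elim: m phi => [|m IH] phi /=.
  split=> [phiv|[z [_]]]; [exists [tuple]; split; first by case|].
    by rewrite (_ : [tuple of _] = v) //; exact: val_inj.
  by rewrite (_ : [tuple of _] = v) //; apply: val_inj; rewrite /= (tuple0 z).
rewrite IH; split=> [[z [zF /holds_FEx[x /holds_FAnd[/holds_FP xF phix]]]]|].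
  exists [tuple of x :: z]; split; first by apply/tuple_inP => y [<-//|yz]; exact: (tuple_inP _ _).1 zF _ yz.
  have E : [tuple of x :: [tuple of z ++ v]] = [tuple of [tuple of x :: z] ++ v] :>
    (m.+1 + n).-tuple N by exact: val_inj.
  by rewrite -E.
move=> [z [zF phiz]]; case/tupleP: z zF phiz => x z /tuple_inP xzF phixz.
exists z; split; first by apply/tuple_inP => y yz; apply: xzF; right.
apply/holds_FEx; exists x; apply/holds_FAnd; split; first by apply/holds_FP/xzF; left.
have E : [tuple of x :: [tuple of z ++ v]] = [tuple of [tuple of x :: z] ++ v] :>
  (m.+1 + n).-tuple N by exact: val_inj.
by rewrite E.
Qed.

(* Moves variable 0 behind the following block of [m] variables. *)
Definition shuffle m n (i : 'I_(m + n).+1) : 'I_(m + n.+1) :=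
  if unlift ord0 i is Some j then
    match fintype.split j with inl a => lshift n.+1 a | inr b => rshift m (lift ord0 b) end
  else rshift m ord0.

Lemma select_shuffle X m n (z : m.-tuple X) x (v : n.-tuple X) :
  select [tuple of z ++ x :: v] (@shuffle m n) = [tuple of x :: [tuple of z ++ v]].
Proof.
apply: eq_from_tnth => i; rewrite tnth_mktuple /shuffle.
case: unliftP => [j ->|->]; last by rewrite tnth_rshift !tnth0.
rewrite tnthS -[j in RHS]splitK; case: fintype.split => a /=.
  by rewrite !tnth_lshift.
by rewrite !tnth_rshift tnthS.
Qed.

(** When [theta] is narrow for [cl], this formula is narrow for [Scl]: its first [m] parameters are
    quantified over the predicate. *)
Definition small_form m n (theta : formula L (m + n).+1) : formula L2 n.+1 :=
  exP (embed (rename theta (@shuffle m n))).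

Lemma holds_small_form m n (theta : formula L (m + n).+1) (v : n.-tuple N) x :
  holds (small_form theta) [tuple of x :: v] <->
  exists z : m.-tuple N, tuple_in (predP N) z /\
    @holds L (reduct N) _ theta [tuple of x :: [tuple of z ++ v]].
Proof.
rewrite holds_exP; split=> -[z [zF H]]; exists z; split=> //.
  by move: H => /holds_embed/holds_rename; rewrite select_shuffle.
by apply/holds_embed/holds_rename; rewrite select_shuffle.
Qed.

End Embed.

(** * Closure of finite tuples; closedness and density read inside [K] *)

Section FiniteClosure.
Variables (L : language) (M : structure L) (cl : set M -> set M).
Hypothesis clP : matroid cl.

Lemma narrow_rename m n (phi : formula L m.+1) (f : 'I_m -> 'I_n) :
  narrow cl phi -> narrow cl (rename phi (up f)).
Proof.
move=> phin a b /holds_rename; rewrite select_up => /phin.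
apply: matroid_mono => // _ [i _ <-]; rewrite tnth_mktuple; exact: imageP.
Qed.

(** Parameters taken from [w] in any order can be renamed to the whole of [w], and dummy parameters
    keep a formula narrow because closure is monotone. *)
Lemma transfer_tuple (N : structure L) n (w : n.-tuple N) a :
  transfer cl (elems w) a <->
  exists2 phi : formula L n.+1, narrow cl phi & holds phi [tuple of a :: w].
Proof.
split=> [[k [phi [u [phin uw phia]]]]|[phi phin phia]]; last first.
  by exists n, phi, w; split=> //; exact/tuple_inP.
have /choice[f fP] i : exists j, tnth w j = tnth u i.
  by have := uw i; rewrite elems_tnth => -[j _ <-]; exists j.
exists (rename phi (up f)); first exact: narrow_rename.
apply/holds_rename; rewrite select_up.
by rewrite (_ : select w f = u) //; apply: eq_from_tnth => i; rewrite tnth_mktuple.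
Qed.

Lemma transfer_elementary (K N : structure L) (e : K -> N) (X : set K) a :
  elementary_embedding e -> transfer cl (e @` X) (e a) -> transfer cl X a.
Proof.
move=> eP [n [phi [u [phin uX phia]]]].
have /choice[w wP] i : exists x, X x /\ e x = tnth u i.
  by have [x Xx xu] := uX i; exists x.
exists n, phi, [tuple w i | i < n]; split=> // [i|].
  by rewrite tnth_mktuple; case: (wP i).
apply/(eP _ phi); rewrite (_ : [tuple of _] = [tuple of e a :: u]) //.
apply: eq_from_tnth => i; rewrite tnth_map.
case: (unliftP ord0 i) => [j ->|->]; last by rewrite !tnth0.
by rewrite !tnthS tnth_mktuple (wP j).2.
Qed.

(** Closedness is stated in the extension [N]: a narrow formula is pushed there along [e], and
    injectivity of [e] brings the conclusion back. *)
Lemma dense_pair_closed kappa (T : theory L) (K : structure L) (F : set K) :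
  dense_pair kappa T cl F -> transfer cl F `<=` F.
Proof.
move=> [_ [N [e [_ eP _ Fcl _]]]] a Fa.
have einj x y : e x = e y -> x = y.
  move=> exy; have := (eP 2 (FEq (TVar ord0) (TVar (lift ord0 ord0))) [tuple x; y]).2.
  by apply.
have : (e @` F) (e a).
  rewrite -Fcl; split; last exact: imageP.
  have [n [phi [u [phin uF phia]]]] := Fa.
  exists n, phi, [tuple of map e u]; split=> // [i|].
    by rewrite tnth_map; exact: imageP.
  have := (eP _ phi [tuple of a :: u]).1 phia.
  by rewrite (_ : [tuple of map e _] = [tuple of e a :: [tuple of map e u]]) //; exact: val_inj.
by move=> [b Fb /einj <-].
Qed.

(** A solution outside the closure of [w] has rank 1 over [w] in [N], as [e] reflects closure; the
    solution set therefore has dimension 1 and meets [F]. *)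
Lemma dense_pair_dense kappa (T : theory L) (K : structure L) (F : set K) :
  dense_pair kappa T cl F -> forall n (phi : formula L n.+1) (w : n.-tuple K) d,
  ~ transfer cl (elems w) d -> holds phi [tuple of d :: w] ->
  exists x, F x /\ holds phi [tuple of x :: w].
Proof.
move=> [_ [N [e [_ eP _ _ Fdense]]]] n phi w d nd phid.
have [|x Fx phix] := Fdense n phi w; last first.
  exists x; split=> //.
  have -> : [tuple of x :: w] = [tuple of [tuple x] ++ w] :> n.+1.-tuple K
    by exact: val_inj.
  exact: phix.
split; last first.
  move=> b r _ [J _ <-]; rewrite -[X in (_ <= X)%N](card_ord 1); exact: max_card.
exists [tuple e d].
  have := (eP _ phi [tuple of d :: w]).1 phid.
  have -> : [tuple of map e [tuple of d :: w]] =
    [tuple of [tuple e d] ++ [tuple of map e w]] :> n.+1.-tuple N by exact: val_inj.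
  exact.
exists [set: 'I_1]%SET; last by rewrite cardsT card_ord.
apply/maxsetP; split; last by move=> J _; rewrite finset.subTset => /eqP.
apply/asboolP => j _ H; apply: nd; apply: transfer_elementary eP _.
move: H; rewrite {2}ord1 (tnth_nth (e d)) /=; apply: transfer_mono.
move=> y [[i _ <-]|[i [_]]]; last by rewrite (ord1 i) (ord1 j).
rewrite tnth_map; apply: imageP; rewrite elems_tnth; exact: imageP.
Qed.

End FiniteClosure.

(** * Genericity over the predicate *)

Lemma eq_diag X (h : seq (X * X)) s : map fst h = s -> map snd h = s -> h = diag s.
Proof. by elim: h s => [|[x y] h IH] [|z s] //= [-> hs] [-> hs']; rewrite (IH s). Qed.

Section PelDiag.
Variables (L : language) (N : structure L).

(** The list is [s], but the arity is literally [size (diag s)], the one that [pel_cons]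
    requires. *)
Definition diag_tuple (s : seq N) := [tuple of map fst (in_tuple (diag s))].

Lemma elems_diag_tuple s : elems (diag_tuple s) = elems s.
Proof. by rewrite /= map_fst_diag. Qed.

Lemma pel_cons_diag (s : seq N) x y :
  (forall phi, holds phi [tuple of x :: diag_tuple s] ->
     holds phi [tuple of y :: diag_tuple s]) -> pel ((x, y) :: diag s).
Proof.
move=> xy; apply: pel_cons => phi /xy.
rewrite (_ : diag_tuple s = [tuple of map snd (in_tuple (diag s))]) //.
by apply: val_inj; rewrite /= map_fst_diag map_snd_diag.
Qed.

Lemma pel_diag_holds (s : seq N) x y n (w : n.-tuple N) (phi : formula L n.+1) :
  pel ((x, y) :: diag s) -> elems w `<=` elems s ->
  holds phi [tuple of x :: w] <-> holds phi [tuple of y :: w].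
Proof.
move=> xyP ws.
have := xyP _ phi [tuple of (x, y) :: [tuple of diag w]].
rewrite (_ : [tuple of map fst _] = [tuple of x :: w]); last first.
  by apply: val_inj; rewrite /= map_fst_diag.
rewrite (_ : [tuple of map snd _] = [tuple of y :: w]); last first.
  by apply: val_inj; rewrite /= map_snd_diag.
apply; apply/tuple_inP => p [<-|/elems_diag[p12 wp]]; first by left.
by right; apply/elems_diag; split=> //; exact: ws.
Qed.

End PelDiag.

(** * Polynomials as terms of the language *)

Section EvalTerm.
Variables (L : language) (S : ring_symbols L).

Definition ring_eval (N : structure L) : seq N -> N -> N :=
  eval_poly (ifun (sym0 S) ([tuple] : 0.-tuple N))
    (fun x y : N => ifun (symD S) [tuple x; y])
    (fun x y : N => ifun (symM S) [tuple x; y]).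

Definition binary_term n (f : Defs.fsym L 2) (s t : term L n) :=
  TFun f (fun i => if i == ord0 then s else t).

Lemma teval_binary (N : structure L) n (f : Defs.fsym L 2) (s t : term L n) (v : n.-tuple N) :
  teval v (binary_term f s t) = ifun f [tuple teval v s; teval v t].
Proof.
by congr (ifun f); apply: eq_from_tnth => -[[|[|//]] i]; rewrite tnth_mktuple !(tnth_nth (teval v s)).
Qed.

(** Coefficients and point are variables, so that elementary relations preserve the value. The
    argument given to [sym0] is a dummy, the arity being 0. *)
Definition eval_term n (s : seq 'I_n) (b : 'I_n) : term L n :=
  foldr (fun i t => binary_term (symD S) (binary_term (symM S) t (TVar b)) (TVar i))
    (TFun (sym0 S) (fun=> TVar b)) s.

Lemma teval_eval (N : structure L) n (s : seq 'I_n) (b : 'I_n) (v : n.-tuple N) :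
  teval v (eval_term s b) = ring_eval [seq tnth v i | i <- s] (tnth v b).
Proof.
elim: s => [|i s IH]; first by congr (ifun _); exact: tuple0.
by rewrite /eval_term [foldr _ _ _]/= -/(eval_term s b) !teval_binary IH.
Qed.

(** The equation is a single formula in the value, the point and the coefficients. *)
Lemma pel_eval (A B : structure L) (g h : seq (A * B)) b b' y y' :
  pel g -> elems h `<=` elems g -> elems g (b, b') -> elems g (y, y') ->
  y = ring_eval (map fst h) b -> y' = ring_eval (map snd h) b'.
Proof.
move=> gP hg gb gy.
pose v := [tuple of (y, y') :: [tuple of (b, b') :: in_tuple h]].
pose s := [seq lift ord0 (lift ord0 i) | i <- enum 'I_(size h)].
have sE C (f : A * B -> C) : [seq tnth [tuple of map f v] i | i <- s] = map f h.
  transitivity (map f (map (tnth (in_tuple h)) (enum 'I_(size h)))).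
    rewrite -!map_comp; apply: eq_map => i /=; by rewrite tnth_map !tnthS.
  by rewrite map_tnth_enum.
have := gP _ (FEq (TVar ord0) (eval_term s (lift ord0 ord0))) v.
rewrite /= !teval_eval !sE !tnth_map !tnthS !tnth0 /= => H; apply: (H _).1.
by apply/tuple_inP => p [<-|[<-|/hg]].
Qed.

End EvalTerm.

Section DensePair.
Variables (kappa : Type) (L : language) (T : theory L) (S : ring_symbols L).
Variables (M : structure L) (cl : set M -> set M).
Hypotheses (kinf : [set: nat] #<= [set: kappa]) (completeT : complete T).
Hypotheses (MP : monster kappa T M) (clP : existential_matroid kappa cl).
Hypothesis domT : expands_integral_domains T S.
Variable Mstar : structure (pair_language L).
Local Notation K := (reduct Mstar).
Local Notation F := (predP Mstar).
Local Notation c := (@transfer L M cl K).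
Hypotheses (pairK : dense_pair kappa T cl F) (richMstar : rich Mstar).

Let KT : models K T. Proof. by case: pairK. Qed.
Let richK : rich K. Proof. exact: rich_reduct. Qed.
Let cP : matroid c. Proof. exact: (transfer_matroid kinf completeT MP clP KT). Qed.
Let generic := pel_generic kinf completeT MP clP KT richK.
Let dcl := transfer_dcl kinf completeT MP clP KT richK.
Let evalK := @ring_eval L S K.

Lemma pel_diag_closed (s : seq K) d x :
  pel ((d, x) :: diag s) -> c (elems s) d <-> c (elems s) x.
Proof.
move=> dx; have := transfer_pel_list cl dx (h := diag s) (a := d) (b := x).
rewrite map_fst_diag map_snd_diag; apply; last by left.
by move=> z; right.
Qed.

(** Density gives a point of [F] in each formula true of [d] over [s]; richness in the language of
    pairs realizes all of them together with the predicate. *)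
Lemma pel_dense (s : seq K) d : ~ c (elems s) d ->
  exists2 x, F x & pel ((d, x) :: diag s).
Proof.
move=> nd; pose w : _.-tuple K := diag_tuple s.
pose tp (phi : formula L (size (diag s)).+1) := holds phi [tuple of d :: w].
have [|||x xP] := @richMstar _ w _
    (fun i : {phi | tp phi} => [set y | F y /\ @holds L K _ (sval i) [tuple of y :: w]]).
- have top : tp (FNot FBot) by [].
  by exists; exists (FNot FBot).
- move=> [phi phid] [psi psid].
  have phipsi : tp (FAnd phi psi) by apply/holds_FAnd.
  by exists (exist tp _ phipsi) => y [Fy /holds_FAnd[]].
- move=> [phi phid]; apply: (dense_pair_dense pairK) phid.
  by rewrite elems_diag_tuple.
have top : tp (FNot FBot) by [].
exists x; first by apply/(holds_FP w); apply: xP; exists (exist tp _ top) => y [Fy _]; exact/holds_FP.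
apply: pel_cons_diag => phi phid; apply/holds_embed; apply: xP.
by exists (exist tp _ phid) => y [_ phiy]; exact/holds_embed.
Qed.

Lemma predicate_closed : c F `<=` F.
Proof. exact: dense_pair_closed pairK. Qed.

(** Each new entry is obtained from [d] by moving it outside the closure of [u] and the previous
    entries, then replacing it by a point of [F] of the same type over these. *)
Lemma predicate_independent (s u : seq K) d n : ~ c (elems s) d ->
  exists xs, [/\ size xs = n, elems xs `<=` F & seq_indep c (elems u) xs].
Proof.
move=> nd; elim: n => [|n [xs [xsn xsF xsP]]]; first by exists [::]; split.
have [|d1 _ nd1] := generic (u ++ xs) (@pel_diag L K s) (d := d).
  by rewrite map_fst_diag.
have {}nd1 : ~ c (elems (u ++ xs)) d1.
  move=> H; apply: nd1; apply: matroid_mono H => // z.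
  by rewrite [elems (_ ++ (_ ++ _))]elems_cat; right.
have [x Fx xP] := pel_dense nd1.
exists (x :: xs); rewrite /= xsn; split=> //; first by move=> y [<-|/xsF].
by split=> //; rewrite -elems_cat -(pel_diag_closed xP).
Qed.

(** The entries are moved one at a time, each outside the closure of [u], [t] and the copies already
    made. *)
Lemma seq_indep_copy (s u t : seq K) : seq_indep c (elems u) s ->
  exists h, [/\ map fst h = s, pel (h ++ diag u) &
    seq_indep c (elems u `|` elems t) (map snd h)].
Proof.
elim: s => [_|x s IH /= [nx us]]; first by exists [::]; split=> //; exact: pel_diag.
have [h [hs hP hi]] := IH us.
have [|x' x'P nx'] := generic t hP (d := x).
  by rewrite map_cat hs map_fst_diag elems_cat setUC.
exists ((x, x') :: h); split=> //=; first by rewrite hs.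
split=> // H; apply: nx'; apply: matroid_mono H => //.
rewrite map_cat map_snd_diag !elems_cat => z [[uz|tz]|hz].
- by left; right.
- by right.
- by left; left.
Qed.

(* The coefficients in [F] of the polynomial are recovered from its values at
   [m.+1] conjugates of [b], which lie in the closure of the same [m] elements
   of [F]. *)
Lemma generic_not_small n m (w : n.-tuple K) d (phi : formula L n.+1) :
  ~ c (elems w) d -> holds phi [tuple of d :: w] ->
  exists x, holds phi [tuple of x :: w] /\
    forall z, elems z `<=` F -> (size z <= m)%N -> ~ c (elems z `|` elems w) x.
Proof.
move=> nd phid; apply: contrapT => Hno.
have small x : holds phi [tuple of x :: w] -> exists z,
    [/\ elems z `<=` F, (size z <= m)%N & c (elems z `|` elems w) x].
  move=> phix; apply: contrapT => Hz; apply: Hno; exists x; split=> // z zF zm zx.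
  by apply: Hz; exists z.
have [b nFb] : exists b, ~ F b.
  have [_ [N [e [_ _ [_ nF] _ _]]]] := pairK.
  by apply/existsNP => FK; apply: nF => x _; exact: FK.
(* [I] is a basis of [b, w] over [F] that contains [b]; [f] is a finite part of [F] over which [I]
   generates [w]. *)
have [I [bI _ FI wI]] : exists I : seq K, [/\ elems [:: b] `<=` elems I,
    elems I `<=` elems [:: b] `|` elems w, seq_indep c F I &
    elems w `<=` c (F `|` elems I)].
  apply: seq_indep_basis => //; split=> // Fb; apply/nFb/predicate_closed.
  by apply: matroid_mono Fb => // x [].
have [f fF wfI] := matroid_fin_elems cP wI.
(* These are the [m] coefficients of positive degree; the constant term will make [m.+1] in all. *)
have [xs [xsm xsF xsP]] := predicate_independent f m nd.
pose W := w ++ b :: xs ++ f.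
have [|d1 d1P nd1] := generic W (@pel_diag L K w) (d := d).
  by rewrite map_fst_diag.
rewrite map_snd_diag in nd1.
(* This constant term, possibly outside [F], gives the polynomial the value [d1] at [b]. *)
have [e eE] : exists e, evalK (e :: xs) b = d1 by exact: eval_poly_head (domT KT) _ _ _.
have ne : ~ c (elems W) e.
  move=> We; apply: nd1; rewrite elems_cat; apply: matroid_mono (_ : c (elems W) d1) => //.
  (* The value is definable from the coefficients and the point, hence lies in their closure. *)
  have : c (elems [:: e, b & xs]) d1.
    apply: dcl => x' x'P; rewrite -eE.
    have := pel_eval x'P (h := diag (e :: xs)) (b := b) (b' := b) (y := d1) (y' := x').
    rewrite map_fst_diag map_snd_diag; apply=> //.
    - by move=> p [<-|xsp]; [right; left|right; right; right].
    - by right; right; left.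
    - by left.
  apply: matroid_sub => // y [<-//|[<-|xsy]]; apply: matroid_ext => //.
    by rewrite elems_cat; right; left.
  by rewrite elems_cat; right; right; apply/List.in_app_iff; left.
(* By density [e] is replaced by [x0] in [F] of the same type over [W]; the new value [y] at [b]
   still satisfies [phi], whose parameters lie in [W]. *)
have [x0 Fx0 x0P] := pel_dense ne.
have nx0 : ~ c (elems W) x0 by rewrite -(pel_diag_closed x0P).
have [y yP] := rich_ext d1 richK x0P.
have yE : y = evalK (x0 :: xs) b.
  have := pel_eval yP (h := (e, x0) :: diag xs) (b := b) (b' := b) (y := d1) (y' := y).
  rewrite /= map_fst_diag map_snd_diag; apply=> //.
  - move=> p [<-|/elems_diag[pp xsp]]; first by right; left.
    right; right; apply/elems_diag; split=> //.
    by rewrite elems_cat; right; right; apply/List.in_app_iff; left.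
  - right; right; apply: (elems_diag W (b, b)).2; split=> //=.
    by rewrite elems_cat; right; left.
  - by left.
have phiy : holds phi [tuple of y :: w].
  have wW : elems w `<=` elems W by rewrite elems_cat; left.
  apply/(pel_diag_holds (s := W) (x := d1)) => //.
    by apply: pel_sub yP => p [<-|Wp]; [left|right; right].
  by apply/(pel_diag_holds _ d1P).
have [z [zF zm zy]] := small y phiy.
set ys := x0 :: xs in yE.
have ysP : seq_indep c (elems f) ys.
  split=> // H; apply: nx0; apply: matroid_mono H => // a faxs.
  rewrite elems_cat elems_cons elems_cat; right; right.
  by case: faxs => [fa|xsa]; [right|left].
pose X := ys ++ f ++ z.
have XF : elems X `<=` F.
  by rewrite !elems_cat => a [[<-|/xsF]|[/fF|/zF]].
have fzX : elems (f ++ z) `<=` elems X by rewrite [elems X]elems_cat => a; right.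
have XI : seq_indep c (elems X) I by exact: seq_indep_sub FI.
have fzIy : c (elems (f ++ z) `|` elems I) y.
  move: zy; apply: matroid_sub => // a; rewrite elems_cat => -[za|/wfI].
    by apply: matroid_ext => //; left; right.
  by apply: matroid_mono => // a' [fa'|Ia']; [left; left|right].
(* [J] collects successive copies of [I] over [X], each independent of the earlier ones. The copy of
   [b] is a new point, where the polynomial has a value in the closure of [f], [z] and that copy of
   [I]. *)
have [J [bs [bsk bsU bsJ XJ bsP]]] : exists J bs,
    [/\ size bs = m.+1, List.NoDup bs, elems bs `<=` elems J,
        seq_indep c (elems X) J & forall a, elems bs a ->
          c (elems (f ++ z) `|` elems J) (evalK ys a)].
  elim: m.+1 => [|k [J [bs [bsk bsU bsJ XJ bsP]]]].
    by exists [::], [::]; split=> //; exact: List.NoDup_nil.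
  have [h [hI hP hX]] := seq_indep_copy J XI.
  have [b' hb'] : exists b', elems h (b, b').
    have : elems I b by apply: bI; left.
    by rewrite -hI elems_map => -[[b1 b'] hb /= <-]; exists b'.
  have [y' y'P] := rich_ext y richK hP.
  have hsub : elems h `<=` elems ((y, y') :: h ++ diag X).
    by rewrite elems_cons elems_cat => p hp; right; left.
  have Xsub p : p.1 = p.2 -> elems X p.1 -> elems ((y, y') :: h ++ diag X) p.
    by move=> p12 Xp; rewrite elems_cons elems_cat; right; right; apply/elems_diag.
  have y'E : y' = evalK ys b'.
    have := pel_eval y'P (h := diag ys) (b := b) (b' := b') (y := y) (y' := y').
    rewrite map_fst_diag map_snd_diag; apply=> //.
    - move=> p /elems_diag[p12 ysp]; apply: Xsub => //.
      by rewrite elems_cat; left.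
    - exact: hsub.
    - by left.
  have hb'J : elems (map snd h) b' by rewrite elems_map; exists (b, b').
  exists (map snd h ++ J), (b' :: bs); split.
  - by rewrite /= bsk.
  - apply: List.NoDup_cons => // /bsJ Jb'.
    apply: (seq_indep_notin cP hX hb'J); apply: matroid_ext => //; by right.
  - by rewrite elems_cat => a [<-|/bsJ]; [left|right].
  - exact: seq_indep_cat.
  - rewrite [elems (map snd h ++ J)]elems_cat => a [<-|/bsP]; last first.
      by apply: matroid_mono => // a' [fza'|Ja']; [left|right; right].
    rewrite -y'E.
    have := transfer_pel_list cl y'P (h := h ++ diag (f ++ z)) (a := y) (b := y').
    rewrite !map_cat hI map_fst_diag map_snd_diag => H.
    have {H} : c (elems (map snd h ++ f ++ z)) y'.
      apply/H; last by rewrite elems_cat setUC.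
        rewrite elems_cat => p [/hsub//|/elems_diag[p12 fzp]]; apply: Xsub => //.
        exact: fzX.
      by left.
    apply: matroid_mono => //; rewrite elems_cat => a' [ha'|fza'].
      by right; left.
    by left.
(* [m.+1] points and their values fix the [m.+1] coefficients, so a conjugate of a coefficient over
   them is equal to it. *)
have ysJ a : elems ys a -> c (elems (f ++ z) `|` elems J) a.
  move=> ysa; apply: (matroid_sub cP (A := elems (bs ++ map (evalK ys) bs))).
    rewrite elems_cat elems_map => a' [bsa'|[b1 bsb1 <-]]; last exact: bsP.
    by apply: matroid_ext => //; right; exact: bsJ.
  apply: dcl => a' a'P.
  have [h [hE hP]] := rich_ext_list ys richK a'P.
  have hE2 : map snd h = ys.
    apply/esym; apply: (eval_poly_inj (domT KT) (bs := bs)) => //.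
    - by rewrite size_map -hE size_map.
    - by rewrite bsk /= xsm.
    move=> b1 bsb1.
    have sub p : elems ((a, a') :: diag (bs ++ map (evalK ys) bs)) p ->
        elems (h ++ (a, a') :: diag (bs ++ map (evalK ys) bs)) p.
      by rewrite elems_cat; right.
    apply: (pel_eval (S := S) hP (b := b1) (y := evalK ys b1)).
    - by rewrite elems_cat; left.
    - apply: sub; right; apply: (elems_diag _ (b1, b1)).2; split=> //=.
      by rewrite elems_cat; left.
    - apply: sub; right; apply: (elems_diag _ (_, _)).2; split=> //=.
      by rewrite elems_cat elems_map; right; exists b1.
    - by rewrite hE.
  have hdiag := eq_diag hE hE2.
  apply: (pel_fun hP (x := a)).
    by rewrite elems_cat; right; left.
  by rewrite elems_cat hdiag; left; apply: (elems_diag _ (_, _)).2.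
(* [J] is independent over a set that contains [ys], so it can be removed: the entries of [ys],
   independent over [f], lie in the closure of [f] and [z]. *)
have : (size ys <= size z)%N.
  apply: (seq_indep_size cP ysP) => a ysa.
  rewrite -elems_cat; apply: (seq_indep_separate cP XJ fzX); last exact: ysJ.
  by rewrite elems_cat; left.
by apply/negP; rewrite -ltnNge /= xsm ltnS.
Qed.

(** * Back and forth *)

(** By finite character it is enough to avoid, for every [m], the closure of [s] with any [m]
    elements of [F]. The base is indexed by a formula true of [d] and a bound [m], so that richness
    handles all of them at once. *)
Lemma pel_large (s : seq K) d : ~ c (elems s) d ->
  exists2 x, pel ((d, x) :: diag s) & ~ c (elems s `|` F) x.
Proof.
move=> nd; pose w : _.-tuple K := diag_tuple s.
have ws : elems w = elems s := elems_diag_tuple s.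
pose tp (p : formula L (size (diag s)).+1 * nat) := holds p.1 [tuple of d :: w].
have [|||x xP] := @richMstar _ w _ (fun i : {p | tp p} => [set y |
    @holds L K _ (sval i).1 [tuple of y :: w] /\ forall z, elems z `<=` F ->
      (size z <= (sval i).2)%N -> ~ c (elems z `|` elems w) y]).
- have top : tp (FNot FBot, 0%N) by [].
  by exists; exists (FNot FBot, 0%N).
- move=> [[phi m] phid] [[psi k] psid].
  have phipsi : tp (FAnd phi psi, maxn m k) by apply/holds_FAnd.
  exists (exist tp _ phipsi) => y [/holds_FAnd[phiy psiy] yP].
  split; split=> // z zF zm; apply: yP => //; apply: leq_trans zm _.
    exact: leq_maxl.
  exact: leq_maxr.
- by move=> [[phi m] phid]; apply: generic_not_small phid; rewrite ws.
exists x.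
  apply: pel_cons_diag => phi phid; apply/holds_embed; apply: xP.
  have phid0 : tp (phi, 0%N) by [].
  by exists (exist tp _ phid0) => y [phiy _]; exact/holds_embed.
rewrite setUC => sFx.
have [|f fF fsx] := matroid_fin_elems cP (s := [:: x]) (F := F) (Y := elems s).
  by move=> y [<-|].
have clM : matroid cl by case: clP => -[].
have [|theta thetan thetax] := (transfer_tuple clM [tuple of in_tuple f ++ w] x).1.
  by rewrite elems_cat -/(elems w) ws; apply: fsx; left.
have top : tp (FNot FBot, size f) by [].
(* The parameters [f] make the small form of [theta] true at [x], but it fails throughout the member
   of the base with bound [size f]. *)
have := xP (FNot (small_form theta)); apply.
  exists (exist tp _ top) => y [_ yP] /holds_small_form[z [/tuple_inP zF zy]].
  apply: (yP z zF); first by rewrite size_tuple.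
  rewrite -elems_cat; apply: (transfer_tuple clM (N := K) [tuple of z ++ w] y).2.
  by exists theta.
by apply/holds_small_form; exists (in_tuple f); split=> //; exact/tuple_inP.
Qed.

Lemma pel_comp_diag (g : seq (K * K)) s d d1 d2 : elems (map snd g) `<=` elems s ->
  pel ((d, d1) :: g) -> pel ((d1, d2) :: diag s) -> pel ((d, d2) :: g).
Proof.
move=> gs gP sP; apply: (pel_comp gP sP) => -[x y] [[<- <-]|gxy].
  by exists d1; left.
exists y; right => //; apply/elems_diag; split=> //; apply: gs.
by rewrite elems_map; exists (x, y).
Qed.

(** Two moves: away from the closure of the range and [u] by [generic], then away from [F] over
    these same elements by [pel_large]. *)
Lemma pel_ext_large (g : seq (K * K)) u d : pel g -> ~ c (elems (map fst g)) d ->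
  exists2 d', pel ((d, d') :: g) & ~ c (elems (map snd g ++ u) `|` F) d'.
Proof.
move=> gP nd; have [d1 d1P nd1] := generic u gP nd.
have [d' d'P nd'] := pel_large nd1; exists d' => //.
by apply: pel_comp_diag d1P d'P; rewrite elems_cat; left.
Qed.

Lemma pel_ext_dense (g : seq (K * K)) d : pel g -> ~ c (elems (map fst g)) d ->
  exists2 d', F d' & pel ((d, d') :: g).
Proof.
move=> gP nd; have [d1 d1P nd1] := generic [::] gP nd.
have [d' Fd' d'P] := pel_dense nd1; exists d' => //.
by apply: pel_comp_diag d1P d'P; rewrite elems_cat; left.
Qed.

(* [s] is independent from [F] over its elements in [F]. *)
Definition free_over_predicate (s : seq K) := exists I,
  [/\ elems I `<=` elems s, seq_indep c F I &
      elems s `<=` c ((elems s `&` F) `|` elems I)].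

Lemma free_cons_closed s d :
  free_over_predicate s -> c (elems s) d -> free_over_predicate (d :: s).
Proof.
move=> [I [Is FI sI]] sd; exists I; split=> //; first by move=> x /Is; right.
rewrite elems_cons => x [->|/sI].
  apply: matroid_sub sd => // y /sI; apply: matroid_mono => // z [[sz Fz]|Iz].
    by left; split=> //; right.
  by right.
by apply: matroid_mono => // z [[sz Fz]|Iz]; [left; split=> //; right|right].
Qed.

Lemma free_cons_predicate s d :
  free_over_predicate s -> F d -> free_over_predicate (d :: s).
Proof.
move=> [I [Is FI sI]] Fd; exists I; split=> //; first by move=> x /Is; right.
rewrite elems_cons => x [->|/sI].
  by apply: matroid_ext => //; left; split=> //; left.
by apply: matroid_mono => // z [[sz Fz]|Iz]; [left; split=> //; right|right].
Qed.

Lemma free_cons_large s d :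
  free_over_predicate s -> ~ c (elems s `|` F) d -> free_over_predicate (d :: s).
Proof.
move=> [I [Is FI sI]] nd; exists (d :: I); split.
- by move=> x [<-|/Is]; [left|right].
- split=> // Id; apply: nd; apply: matroid_mono Id => // x [Fx|/Is sx]; by [right|left].
- rewrite !elems_cons => x [->|/sI].
    by apply: matroid_ext => //; right; left.
  apply: matroid_mono => // z [[sz Fz]|Iz]; first by left; split=> //; right.
  by right; right.
Qed.

(** A basis of [s] over [F] generates [s] with the help of finitely many elements of [F]; these are
    the ones to add. *)
Lemma free_cat_predicate s : exists2 f, elems f `<=` F & free_over_predicate (f ++ s).
Proof.
have [I [_ Is FI sI]] := seq_indep_basis cP s (D := F) (t := [::]) Logic.I.
have [f fF sfI] := matroid_fin_elems cP sI; exists f => //; exists I; split=> //.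
  by rewrite elems_cat => x /Is[//|sx]; right.
move=> x; rewrite [elems (f ++ s)]elems_cat => -[fx|/sfI].
  by apply: matroid_ext => //; left; split; [left|exact: fF].
by apply: matroid_mono => // z [fz|Iz]; [left; split; [left|exact: fF]|right].
Qed.

(** The list [s] is generated by its part in [F] and by a list independent over [F], which cannot
    contribute to an element of [F]. *)
Lemma free_predicate_closed s d :
  free_over_predicate s -> F d -> c (elems s) d -> c (elems s `&` F) d.
Proof.
move=> [I [Is FI sI]] Fd sd.
apply: (seq_indep_separate cP FI) => //.
exact: (matroid_sub cP sI sd).
Qed.

(** Agreement on [F] is imposed at the listed elements only; freeness propagates it to their
    closure. *)
Definition back_and_forth (g : seq (K * K)) := [/\ pel g,
  forall p, elems g p -> F p.1 <-> F p.2,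
  free_over_predicate (map fst g) & free_over_predicate (map snd g)].

Lemma back_and_forth_swap g :
  back_and_forth g -> back_and_forth (map (@swap _ _) g).
Proof.
move=> [gP gF g1 g2]; split.
- exact: pel_swap.
- by rewrite elems_map => _ [[x y] gxy <-] /=; rewrite (gF _ gxy).
- by rewrite -map_comp.
- by rewrite -map_comp.
Qed.

(** By freeness [d] depends only on the part of the domain in [F]; the image of that part lies in
    [F], which is closed. The reverse direction will come from the inverse relation. *)
Lemma pel_closed_predicate (g : seq (K * K)) d d' : pel ((d, d') :: g) ->
  (forall p, elems g p -> F p.1 -> F p.2) -> free_over_predicate (map fst g) ->
  c (elems (map fst g)) d -> F d -> F d'.
Proof.
move=> gP gF gfree gd Fd; apply: predicate_closed.
have := free_predicate_closed gfree Fd gd.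
have -> : elems (map fst g) `&` F = fst @` [set p | elems g p /\ F p.1].
  rewrite elems_map; apply/seteqP; split=> [_ [[p gp <-] Fp]|_ [p [gp Fp] <-]].
    by exists p.
  by split=> //; exists p.
move=> /(transfer_pel gP (b := d') _) H.
have {}H : c (snd @` [set p | elems g p /\ F p.1]) d'.
  by apply: H; [move=> p [gp _]; right|left].
by apply: matroid_mono H => // _ [p [gp Fp] <-]; exact: gF Fp.
Qed.

Lemma forth_closed g d : back_and_forth g -> c (elems (map fst g)) d ->
  exists d', back_and_forth ((d, d') :: g).
Proof.
move=> gbf gd; have [gP gF g1 g2] := gbf; have [d' d'P] := rich_ext d richK gP.
have gd' : c (elems (map snd g)) d'.
  by apply: (transfer_pel_list cl d'P _ _).1 gd; [right|left].
exists d'; split=> //; [|exact: free_cons_closed|exact: free_cons_closed].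
move=> p [<-|/gF//] /=; split.
  by apply: (pel_closed_predicate d'P) => // q gq; rewrite (gF _ gq).
have [sP sF s1 s2] := back_and_forth_swap gbf.
apply: (pel_closed_predicate (g := map (@swap _ _) g)) => //.
- exact: (pel_swap d'P).
- by move=> q gq; rewrite (sF _ gq).
- by rewrite -map_comp.
Qed.

Lemma forth_predicate g d : back_and_forth g -> F d ->
  exists d', back_and_forth ((d, d') :: g).
Proof.
move=> gbf Fd; have [gd|ngd] := pselect (c (elems (map fst g)) d).
  exact: forth_closed.
have [gP gF g1 g2] := gbf; have [d' Fd' d'P] := pel_ext_dense gP ngd.
exists d'; split=> //; [|exact: free_cons_predicate|exact: free_cons_predicate].
by move=> p [<-|/gF//].
Qed.

(** The list [u] serves Existence, where the new point must avoid more than the range; it is empty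
    when only an extension is wanted. *)
Lemma forth_large g d u : back_and_forth g -> ~ c (elems (map fst g) `|` F) d ->
  exists2 d', back_and_forth ((d, d') :: g) & ~ c (elems u `|` F) d'.
Proof.
move=> [gP gF g1 g2] nd.
have [|d' d'P nd'] := pel_ext_large u gP (d := d).
  by move=> H; apply: nd; apply: matroid_mono H => //; left.
have ngd' : ~ c (elems (map snd g) `|` F) d'.
  move=> H; apply: nd'; apply: matroid_mono H => //.
  by rewrite elems_cat; apply: setSU; left.
exists d'; last first.
  by move=> H; apply: nd'; apply: matroid_mono H => //; rewrite elems_cat; apply: setSU; right.
split=> //; [|exact: free_cons_large|exact: free_cons_large].
move=> p [<-|/gF//] /=; split=> [Fd|Fd'].
  by case: nd; apply: matroid_ext => //; right.
by case: ngd'; apply: matroid_ext => //; right.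
Qed.

(** When [d] lies in the closure of the domain and [F], the finitely many elements of [F] that it
    needs are added first; this is why several pairs may be added. *)
Lemma forth g d : back_and_forth g -> exists2 h, elems g `<=` elems h &
  back_and_forth h /\ exists d', elems h (d, d').
Proof.
move=> gbf; have [gd|ngd] := pselect (c (elems (map fst g) `|` F) d); last first.
  have [d' d'P _] := forth_large [::] gbf ngd; exists ((d, d') :: g).
    by move=> p; right.
  by split=> //; exists d'; left.
have [f fF fd] : exists2 f, elems f `<=` F & c (elems f `|` elems (map fst g)) d.
  rewrite setUC in gd.
  have [|f fF fP] := matroid_fin_elems cP (s := [:: d]) (F := F) (Y := elems (map fst g)).
    by move=> y [<-|].
  by exists f => //; apply: fP; left.
have [h gh [hbf hf]] : exists2 h, elems g `<=` elems h &
    back_and_forth h /\ elems f `<=` elems (map fst h).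
  elim: f fF {fd} => [|x f IH] fF; first by exists g => //; split.
  have [h gh [hbf hf]] := IH (fun y fy => fF y (or_intror fy)).
  have [x' x'P] := forth_predicate hbf (fF x (or_introl erefl)).
  exists ((x, x') :: h); first by move=> p /gh; right.
  by split=> // y [<-|/hf]; [left|right].
have [|d' d'P] := forth_closed (d := d) hbf.
  apply: matroid_mono fd => // x [/hf//|].
  by rewrite !elems_map => -[p /gh hp <-]; exists p.
exists ((d, d') :: h); first by move=> p /gh; right.
by split=> //; exists d'; left.
Qed.

Lemma back g d' : back_and_forth g -> exists2 h, elems g `<=` elems h &
  back_and_forth h /\ exists d, elems h (d, d').
Proof.
move=> /back_and_forth_swap/(forth d')[h gh [hbf [d hd]]].
exists (map (@swap _ _) h).
  move=> [x y] gxy; rewrite elems_map; exists (y, x) => //; apply: gh.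
  by rewrite elems_map; exists (x, y).
split; first exact: back_and_forth_swap.
by exists d; rewrite elems_map; exists (d', d).
Qed.

(** The value of a term need not be listed: it is added by [forth], and its image is the value of
    the same term on the other side. *)
Lemma back_and_forth_predicate_term g n (t : term L n) (v : n.-tuple (K * K)) :
  back_and_forth g -> tuple_in (elems g) v ->
  F (teval [tuple of map fst v] t) <-> F (teval [tuple of map snd v] t).
Proof.
move=> gbf vg; set a := teval _ t.
have [h gh [[hP hF _ _] [a' ha']]] := forth a gbf.
have := hP _ (FEq (TVar ord0) (rename_term (lift ord0) t)) [tuple of (a, a') :: v].
rewrite /= !teval_rename.
have E (f : K * K -> K) : select [tuple of map f [tuple of (a, a') :: v]] (lift ord0) =
    [tuple of map f v].
  by apply: eq_from_tnth => i; rewrite tnth_mktuple !tnth_map tnthS.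
rewrite !E !tnth_map !tnth0 /= => H.
have <- : a' = teval [tuple of map snd v] t.
  apply: (H _).1 => //; apply/tuple_inP => p [<-//|vp].
  by apply: gh; exact: (tuple_inP _ _).1 vg _ vp.
exact: hF _ ha'.
Qed.

(** Old atomic formulas are read in the reduct, where [g] is elementary; quantifiers use [forth] and
    [back], so the induction must let [g] vary. *)
Lemma back_and_forth_holds n (psi : formula (pair_language L) n)
    (v : n.-tuple (K * K)) g : back_and_forth g -> tuple_in (elems g) v ->
  @holds _ Mstar n psi [tuple of map fst v] <->
  @holds _ Mstar n psi [tuple of map snd v].
Proof.
elim: psi v g => {n} [n|n s t|n k r ts|n phi IH psi IH'|n phi IH] v g gbf vg //.
- have [gP _ _ _] := gbf; have := gP _ (FEq (restrict_term s) (restrict_term t)) v vg.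
  by rewrite /= !teval_restrict.
- case: r ts => {k} [k r|] ts; last first.
    have := back_and_forth_predicate_term (restrict_term (ts ord0)) gbf vg.
    rewrite !teval_restrict /predP /=.
    have E (u : n.-tuple Mstar) : [tuple teval u (ts i) | i < 1] = [tuple teval u (ts ord0)].
      by apply: eq_from_tnth => i; rewrite tnth_mktuple ord1 tnth0.
    by rewrite !E.
  have [gP _ _ _] := gbf; have := gP _ (FRel r (fun i => restrict_term (ts i))) v vg.
  rewrite /=.
  have E (u : n.-tuple Mstar) : [tuple @teval L K n u (restrict_term (ts i)) | i < k] =
    [tuple teval u (ts i) | i < k] by apply: eq_mktuple => i; exact: teval_restrict.
  by rewrite !E.
- by rewrite /= (IH v g gbf vg) (IH' v g gbf vg).
- have step x y h : elems g `<=` elems h -> back_and_forth h -> elems h (x, y) ->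
      @holds _ Mstar _ phi [tuple of x :: [tuple of map fst v]] <->
      @holds _ Mstar _ phi [tuple of y :: [tuple of map snd v]].
    move=> gh hbf hxy; have := IH [tuple of (x, y) :: v] h hbf.
    have -> : [tuple of map fst [tuple of (x, y) :: v]] =
      [tuple of x :: [tuple of map fst v]] by exact: val_inj.
    have -> : [tuple of map snd [tuple of (x, y) :: v]] =
      [tuple of y :: [tuple of map snd v]] by exact: val_inj.
    apply; apply/tuple_inP => p [<-//|vp].
    by apply: gh; exact: (tuple_inP _ _).1 vg _ vp.
  split=> /= H x.
    have [h gh [hbf [y hxy]]] := back x gbf.
    exact/(step _ _ _ gh hbf hxy)/H.
  have [h gh [hbf [y hxy]]] := forth x gbf.
  exact/(step _ _ _ gh hbf hxy)/H.
Qed.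

(** The identity on [b] is made free by adding elements of [F], which leaves [a] outside the closure
    of the domain and [F]; then [forth_large] applies. *)
Lemma finite_existence (b u : seq K) a : ~ c (elems b `|` F) a ->
  exists2 x, (forall n (psi : formula (pair_language L) n.+1) (w : n.-tuple Mstar),
      elems w `<=` elems b ->
      holds psi [tuple of a :: w] <-> holds psi [tuple of x :: w]) &
    ~ c (elems u `|` F) x.
Proof.
move=> nba; have [f fF fb] := free_cat_predicate b.
have [||x xbf nx] := @forth_large (diag (f ++ b)) a u.
- split; rewrite ?map_fst_diag ?map_snd_diag //; first exact: pel_diag.
  by move=> p /elems_diag[<-].
- rewrite map_fst_diag => H; apply: nba; apply: matroid_mono H => //.
  by rewrite elems_cat => z [[/fF Fz|bz]|Fz]; [right|left|right].
exists x => // n psi w wb.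
have := back_and_forth_holds psi (v := [tuple of (a, x) :: [tuple of diag w]]) xbf.
rewrite (_ : [tuple of map fst _] = [tuple of a :: w]); last first.
  by apply: val_inj; rewrite /= map_fst_diag.
rewrite (_ : [tuple of map snd _] = [tuple of x :: w]); last first.
  by apply: val_inj; rewrite /= map_snd_diag.
apply; apply/tuple_inP => p [<-|/elems_diag[p12 wp]]; first by left.
by right; apply/elems_diag; split=> //; rewrite elems_cat; right; exact: wb.
Qed.

End DensePair.

(** * The small closure *)

(** [FBot] alone provides one formula of each arity. *)
Lemma infinite_kappa L kappa : theory_card_lt L kappa -> [set: nat] #<= [set: kappa].
Proof.
move=> [Lk _]; apply: card_le_trans Lk; apply/card_le_relP.
exists (fun n p => p = existT (formula L) n FBot); split=> [n _|n n' p -> E].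
  by exists (existT (formula L) n FBot).
exact: (f_equal (@projT1 nat (formula L)) E).
Qed.

Section Scl.
Variables (L : language) (M : structure L) (cl : set M -> set M).
Variable Mstar : structure (pair_language L).
Hypothesis clP : matroid cl.

(** The parameters of a narrow formula are split into those from [A] and those from the predicate,
    and the latter are quantified by [small_form]. *)
Lemma Scl_definable (A : set Mstar) :
  matroid (@Scl L M cl Mstar) ->
  Scl cl A = formula_closure (@narrow _ Mstar (@Scl L M cl Mstar)) A.
Proof.
move=> SclP; apply/seteqP; split=> [a|a [n [phi [w [phin wA phia]]]]]; last first.
  apply: (matroid_mono SclP) (phin _ _ phia) => _ [i _ <-]; exact: wA.
move=> /transfer_finitary[s /elems_subU[t [f [tA fF sE]]] sa].
have [|theta thetan thetaa] :=
    (transfer_tuple clP (N := reduct Mstar) [tuple of in_tuple f ++ in_tuple t] a).1.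
  by apply: transfer_mono sa; rewrite sE elems_cat setUC.
exists (size t), (small_form theta), (in_tuple t); split.
- move=> x v /holds_small_form[z [zF zx]].
  have : @transfer L M cl (reduct Mstar) (elems (z ++ v)) x.
    by apply: (transfer_tuple clP (N := reduct Mstar) [tuple of z ++ v] x).2; exists theta.
  apply: transfer_mono; rewrite elems_cat => y [zy|].
    by right; exact: (tuple_inP _ _).1 zF _ zy.
  by rewrite elems_tnth; left.
- exact/tuple_inP.
- by apply/holds_small_form; exists (in_tuple f); split=> //; exact/tuple_inP.
Qed.

(** Compactness: the base is indexed by a finite part [b] of [B], over which the type of [a] is
    kept, and a finite list [u], whose closure is avoided. Saturation is used over [B] and [C]
    together. *)
Lemma Scl_existence kappa :
  [set: nat] #<= [set: kappa] -> saturated kappa Mstar ->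
  matroid (@Scl L M cl Mstar) ->
  (forall (b u : seq Mstar) a, ~ Scl cl (elems b) a ->
    exists2 x, (forall n (psi : formula (pair_language L) n.+1) (w : n.-tuple Mstar),
        elems w `<=` elems b ->
        holds psi [tuple of a :: w] <-> holds psi [tuple of x :: w]) &
      ~ Scl cl (elems u) x) ->
  existence kappa (@Scl L M cl Mstar).
Proof.
move=> kinf satM SclP fin a B C smallB smallC nBa.
pose I := {p : seq Mstar * seq Mstar | elems p.1 `<=` B}.
have sub0 : elems ([::] : seq Mstar) `<=` B by [].
pose U (i : {p : seq Mstar * seq Mstar | elems p.1 `<=` B}) := [set x |
  (forall n (psi : formula (pair_language L) n.+1) (w : n.-tuple Mstar),
    elems w `<=` elems (sval i).1 ->
    holds psi [tuple of a :: w] <-> holds psi [tuple of x :: w]) /\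
  ~ Scl cl (elems (sval i).2) x].
have [||||x xP] := saturated_base (P := B `|` C) (U := U) satM.
- exact: small_setU.
- by exists; exists ([::], [::]).
- move=> [[b u] bB] [[b' u'] bB']; have bbB : elems (b ++ b') `<=` B.
    by rewrite elems_cat => y [/bB|/bB'].
  exists (exist (fun p : seq Mstar * seq Mstar => elems p.1 `<=` B) (b ++ b', u ++ u') bbB).
  move=> y [/= yP yu]; split; split=> /=.
  + by move=> n psi w wb; apply: yP; rewrite elems_cat => z /wb; left.
  + move=> H; apply: yu; apply: (matroid_mono SclP) H.
    by rewrite elems_cat; left.
  + by move=> n psi w wb; apply: yP; rewrite elems_cat => z /wb; right.
  + move=> H; apply: yu; apply: (matroid_mono SclP) H.
    by rewrite elems_cat; right.
- move=> [[b u] bB]; have [|x xP xu] := fin b u a; last by exists x.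
  by move=> H; apply: nBa; apply: (matroid_mono SclP) H.
exists x; split.
  have half (f : pformula Mstar) : pover B f -> pholds f a -> pholds f x.
    move=> fB fa; apply: xP; first by move=> i; left; exact: fB.
    have /tuple_inP fB' := fB.
    exists (exist (fun p : seq Mstar * seq Mstar => elems p.1 `<=` B)
      (tval (pparams f), [::]) fB') => y [yP _].
    by apply/(yP _ (pform f) (pparams f)).
  move=> f fB; split; first exact: half.
  move=> fx; apply: contrapT => nfa.
  by have := half (PFormula (FNot (pform f)) (pparams f)) fB nfa; apply.
(* Membership in the closure would be witnessed by a narrow [psi] over some [w], whose negation
   holds throughout the member of the base given by [u = w]. *)
rewrite Scl_definable // => -[n [psi [w [psin wBC psix]]]].
have := xP (PFormula (FNot psi) w) wBC; apply=> //.
exists (exist (fun p : seq Mstar * seq Mstar => elems p.1 `<=` B) ([::], tval w) sub0).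
by move=> y [_ yw] psiy; apply: yw; rewrite /= elems_tnth; exact: psin psiy.
Qed.

End Scl.

Theorem lemma8p29
  (L : language) (S : ring_symbols L) (T : theory L) (kappa : Type)
  (M : structure L) (cl : set M -> set M)
  (Td : theory (pair_language L)) (Mstar : structure (pair_language L)) :
  complete T ->
  only_infinite_models T ->
  expands_integral_domains T S ->
  theory_card_lt L kappa ->
  monster kappa T M ->
  existential_matroid kappa cl ->
  dense_pair_theory kappa T cl Td ->
  monster kappa Td Mstar ->
  existential_matroid kappa (@Scl L M cl Mstar).
Proof.
move=> completeT _ domT /infinite_kappa kinf MP clP TdP [MstarTd satMstar _].
have pairK := (TdP Mstar).1 MstarTd.
have clM : matroid cl by case: clP => -[].
have SclP : matroid (@Scl L M cl Mstar).
  have KT : models (reduct Mstar) T by case: pairK.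
  exact: (matroid_localize (transfer_matroid kinf completeT MP clP KT) (predP Mstar)).
split.
- by split=> // A; exact: Scl_definable.
- apply: Scl_existence => // b u a.
  exact: (finite_existence kinf completeT MP clP domT pairK (saturated_rich kinf satMstar)).
(* If [Scl] were trivial, the closure of the predicate would be everything; being closed, the
   predicate would not be proper. *)
- move=> SclT; have [_ [N [e [_ _ [_ nF] _ _]]]] := pairK; apply: nF => x _.
  apply: (dense_pair_closed pairK).
  have : @Scl L M cl Mstar set0 x by rewrite SclT.
  by apply: transfer_mono => y [].
Qed.
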